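(* Let $d\ge2$, let $Y$ be a real random variable, $R$ a $\{0,1\}$-valued random variable, $\boldsymbol{X}$ a random vector, $V$ a real random variable, $\overline{\boldsymbol{Z}}$ a random vector in $\mathbb{R}^{d-2}$, and let $\Theta$ (real) and $\overline{\boldsymbol{\Gamma}}$ (in $\mathbb{R}^{d-2}$) be unobservable random elements such that: (a) $R=1\{V-\Theta-\overline{\boldsymbol{\Gamma}}^\top\overline{\boldsymbol{Z}}>0\}$; (b) $(V,\overline{\boldsymbol{Z}}^\top)$ is independent of $(\Theta,\overline{\boldsymbol{\Gamma}}^\top,Y)$ given $\boldsymbol{X}$; (c) for all $(\boldsymbol{x}^\top,\overline{\boldsymbol{z}}^\top)\in\mathrm{supp}(\boldsymbol{X}^\top,\overline{\boldsymbol{Z}}^\top)$, the conditional densities $f_{\Theta,\overline{\boldsymbol{\Gamma}}|\boldsymbol{X}=\boldsymbol{x}}$ and $f_{\Theta+\overline{\boldsymbol{\Gamma}}^\top\overline{\boldsymbol{z}}|\boldsymbol{X}=\boldsymbol{x}}$ (with respect to Lebesgue measure) exist. Assume moreover that one of the following holds: (d1) for all $(\boldsymbol{x},\overline{\boldsymbol{z}})\in\mathrm{supp}(\boldsymbol{X},\overline{\boldsymbol{Z}})$, $\mathrm{supp}(V|\boldsymbol{X}=\boldsymbol{x},\overline{\boldsymbol{Z}}=\overline{\boldsymbol{z}})\supseteq\mathrm{supp}(\Theta+\overline{\boldsymbol{\Gamma}}^\top\overline{\boldsymbol{z}}|\boldsymbol{X}=\boldsymbol{x})$, and for all $\boldsymbol{x}\in\mathrm{supp}(\boldsymbol{X})$,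 $\mathrm{supp}(\overline{\boldsymbol{Z}}|\boldsymbol{X}=\boldsymbol{x})=\mathbb{R}^{d-2}$; (d2) there are given identifying classes $\Phi_{\boldsymbol{x}}$ and quasi-analytic classes $\mathcal{C}^a_{\boldsymbol{x},\overline{\boldsymbol{z}}}$ (of functions on $\mathbb{R}$) and $\mathcal{C}^b_{s,\boldsymbol{x}}$ (of functions on $\mathbb{R}^{d-2}$) such that, for all $(\boldsymbol{x}^\top,\overline{\boldsymbol{z}}^\top)\in\mathrm{supp}(\boldsymbol{X}^\top,\overline{\boldsymbol{Z}}^\top)$, the sets $\mathrm{supp}(V|\boldsymbol{X}=\boldsymbol{x},\overline{\boldsymbol{Z}}=\overline{\boldsymbol{z}})$ and $\mathrm{supp}(\overline{\boldsymbol{Z}}|\boldsymbol{X}=\boldsymbol{x})$ have nonempty interiors and, for all $\phi\in\Phi_{\boldsymbol{x}}$, $a_{\phi,\boldsymbol{x},\overline{\boldsymbol{z}}}\in\mathcal{C}^a_{\boldsymbol{x},\overline{\boldsymbol{z}}}$ and, for all $s\in\mathbb{R}$, $b_{\phi,s,\boldsymbol{x}}\in\mathcal{C}^b_{s,\boldsymbol{x}}$, where $$a_{\phi,\boldsymbol{x},\overline{\boldsymbol{z}}}(v)=\mathbb{E}[\phi(Y)|\Theta+\overline{\boldsymbol{\Gamma}}^\top\overline{\boldsymbol{z}}=v,\boldsymbol{X}=\boldsymbol{x}]\,f_{\Theta+\overline{\boldsymbol{\Gamma}}^\top\overline{\boldsymbol{z}}|\boldsymbol{X}=\boldsymbol{x}}(v),\quad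 v\in\mathbb{R},$$ $$b_{\phi,s,\boldsymbol{x}}(\boldsymbol{t})=\mathbb{E}\left[e^{i\Theta s}e^{i(\overline{\boldsymbol{\Gamma}}^\top\boldsymbol{t})s}\phi(Y)\,\big|\,\boldsymbol{X}=\boldsymbol{x}\right],\quad \boldsymbol{t}\in\mathbb{R}^{d-2}.$$ Then, for all $\boldsymbol{x}\in\mathrm{supp}(\boldsymbol{X})$, the law of $(Y,\Theta,\overline{\boldsymbol{\Gamma}}^\top)$ conditional on $\boldsymbol{X}=\boldsymbol{x}$ is identified.
   Context: Origin of the model: a random coefficients selection equation $R=1\{A+\boldsymbol{B}^\top\boldsymbol{Z}>0\}$ with instruments $\boldsymbol{Z}\in\mathbb{R}^{d-1}$ and an invertible matrix $\boldsymbol{P}_{\boldsymbol{x}}$ such that $(\boldsymbol{P}_{\boldsymbol{x}}^\top\boldsymbol{B})_1>0$ a.s.; then $V=(\boldsymbol{P}_{\boldsymbol{x}}^{-1}\boldsymbol{Z})_1$, $\overline{\boldsymbol{Z}}=(\boldsymbol{P}_{\boldsymbol{x}}^{-1}\boldsymbol{Z})_{2,\dots,d-1}$, $\Theta=-A/(\boldsymbol{P}_{\boldsymbol{x}}^\top\boldsymbol{B})_1$, $\overline{\boldsymbol{\Gamma}}=-(\boldsymbol{P}_{\boldsymbol{x}}^\top\boldsymbol{B})_{2,\dots,d-1}/(\boldsymbol{P}_{\boldsymbol{x}}^\top\boldsymbol{B})_1$. The matrix $\boldsymbol{P}_{\boldsymbol{x}}$ is treated as known, so $V$ and $\overline{\boldsymbol{Z}}$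 are observed. (For $d=2$ the components in $\mathbb{R}^{d-2}=\mathbb{R}^0$ are absent.) Observed data: $(\boldsymbol{X},V,\overline{\boldsymbol{Z}},R)$ is always observed, and $Y$ is observed only when $R=1$; so the distribution of the observed data is the law of $(\boldsymbol{X},V,\overline{\boldsymbol{Z}},R,RY)$. Identified: a feature of the model is identified if it is determined by the distribution of the observed data together with the model assumptions, i.e. any two structures satisfying all the assumptions (under (d2), with the same given classes) and generating the same law of $(\boldsymbol{X},V,\overline{\boldsymbol{Z}},R,RY)$ have the same value of that feature. Identifying class: a set $\Phi$ of bounded measurable functions $\phi:\mathbb{R}\to\mathbb{R}$ such that a finite positive Borel measure $\nu$ on $\mathbb{R}$ (an admissible law of $Y$, up to mass) is determined by the integrals $\int\phi\,d\nu$, $\phi\in\Phi$. Examples: all bounded measurable functions; $\{1\{\cdot\le t\}:t\in\mathbb{R}\}$; $\{\cos(t\,\cdot),\sin(t\,\cdot):t\in\mathbb{R}\}$. Quasi-analytic class: a class of infinitely differentiable (possibly complex-valued) functions, defined by controls on the sup-norms of all derivatives, such that any two members having the same value and the same derivatives of all orders at one point coincide everywhere. $\mathrm{supp}(U|\cdot)$ is the support of the corresponding conditional law. ''For all $\boldsymbol{x}\in\mathrm{supp}(\boldsymbol{X})$'' (and similarly for $(\boldsymbol{x},\overline{\boldsymbol{z}})$) is literal on the discrete part of the law and means a.e. on the continuous part. Equalities of random variables are almost sure. *)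

(* Defs.v *)
From HB Require Import structures.
From mathcomp Require Import all_boot all_order all_algebra.
From mathcomp Require Import complex.
From mathcomp Require Import all_classical all_reals all_analysis.

Set Implicit Arguments.
Unset Strict Implicit.
Unset Printing Implicit Defensive.

Import Order.TTheory GRing.Theory Num.Theory.
Import numFieldNormedType.Exports.

Local Open Scope classical_set_scope.
Local Open Scope complex_scope.
Local Open Scope ring_scope.

(* R^n is 'rV[R]_n, which the library equips with its topology but not with a
   sigma-algebra; as for tuples, we take the one generated by the coordinates,
   i.e. the Borel sigma-algebra. *)

Definition rV_display : measure_display -> measure_display.
Proof. exact. Qed.

Section measurable_rV.
Context (R : realType) (n : nat).

Definition rV_coor (i : 'I_n) (v : 'rV[R]_n) : R := v ord0 i.

Let rV_set0 : g_sigma_preimage rV_coor set0.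
Proof. exact: sigma_algebra0. Qed.

Let rV_setC A : g_sigma_preimage rV_coor A -> g_sigma_preimage rV_coor (~` A).
Proof. exact: sigma_algebraC. Qed.

Let rV_bigcup (F : (set 'rV[R]_n)^nat) :
  (forall i, g_sigma_preimage rV_coor (F i)) ->
  g_sigma_preimage rV_coor (\bigcup_i (F i)).
Proof. exact: sigma_algebra_bigcup. Qed.

HB.instance Definition _ :=
  @isMeasurable.Build (rV_display default_measure_display)
    'rV[R]_n (g_sigma_preimage rV_coor) rV_set0 rV_setC rV_bigcup.

End measurable_rV.

Lemma measurable_fun_rVP d (T : measurableType d) (R : realType) n
    (f : T -> 'rV[R]_n) :
  measurable_fun setT f <->
  forall i, measurable_fun setT (fun t => f t ord0 i).
Proof.
apply: (@iff_trans _ (g_sigma_preimage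
    (fun i => @rV_coor R n i \o f) `<=` measurable)).
  rewrite g_sigma_preimage_comp; split=> [mf A [/= C preC <-]|prefS].
    exact: mf.
  by move=> _ A mA; apply: prefS; exists A.
split=> [cfS i|mf].
- move=> _ A mA.
  apply: cfS; apply: sub_sigma_algebra.
  case: n i => [[] []//|n i] in f *.
  rewrite -bigcup_mkord_ord.
  exists i; first exact: ltn_ord.
  by exists A => //; rewrite inord_val.
- apply: smallest_sub; first exact: sigma_algebra_measurable.
  case: n => [|n] in f mf *; first by rewrite big_ord0.
  rewrite -bigcup_mkord_ord; apply: bigcup_sub => i Ii.
  by move=> A [B mB <-]; exact: mf.
Qed.

Section lebesgue_rV.
Context (R : realType).

Definition cons_rV n (u : R * 'rV[R]_n) : 'rV[R]_n.+1 := row_mx u.1%:M u.2.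

Lemma measurable_cons_rV n : measurable_fun setT (@cons_rV n).
Proof.
apply/measurable_fun_rVP => i.
case: (@splitP 1 n i) => [j ij|j ij].
- have -> : i = lshift n j by exact/val_inj.
  have -> : (fun u : R * 'rV[R]_n => cons_rV u ord0 (lshift n j)) = fst.
    by apply/funext => u; rewrite /cons_rV (@row_mxEl _ _ 1 n) (ord1 j) mxE eqxx mulr1n.
  exact: measurable_fst.
- have -> : i = rshift 1 j by exact/val_inj.
  have -> : (fun u : R * 'rV[R]_n => cons_rV u ord0 (rshift 1 j)) =
            (fun v : 'rV[R]_n => v ord0 j) \o snd.
    by apply/funext => u; rewrite /cons_rV (@row_mxEr _ _ 1 n).
  apply: measurableT_comp => //.
  by have /measurable_fun_rVP := @measurable_id _ 'rV[R]_n setT.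
Qed.

(* Lebesgue measure on R^n: the point mass on R^0, and the image of the product
   of Lebesgue measures on R and R^n on R^(n+1). *)
Fixpoint lebesgue_rV n : {measure set 'rV[R]_n -> \bar R} :=
  match n with
  | 0 => \d_ (0 : 'rV[R]_0)
  | m.+1 => measure_function_pushforward__canonical__measure_function_Measure
      (lebesgue_measure \x^ lebesgue_rV m)%E (@measurable_cons_rV m)
  end.

End lebesgue_rV.

Section conditional_laws.
Context d (T : measurableType d) (R : realType) (P : probability T R).
Local Open Scope ereal_scope.

Section joint.
Context d1 d2 (T1 : measurableType d1) (T2 : measurableType d2).

Definition rv_pair (f : {RV P >-> T1}) (g : {RV P >-> T2}) (w : T) : T1 * T2 :=
  (f w, g w).

Lemma measurable_rv_pair f g : measurable_fun setT (rv_pair f g).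
Proof. exact: measurable_fun_pair. Qed.

HB.instance Definition _ f g :=
  isMeasurableFun.Build _ _ _ _ (rv_pair f g) (measurable_rv_pair f g).

End joint.

Section given.
Context dX (TX : measurableType dX) (X : {RV P >-> TX}).

(* [k x] is the law of [U] conditional on [X = x], in a regular version. *)
Definition is_cond_law dU (TU : measurableType dU) (U : {RV P >-> TU})
    (k : R.-pker TX ~> TU) : Prop :=
  forall A B, measurable A -> measurable B ->
    P (X @^-1` A `&` U @^-1` B) = \int[distribution P X]_(x in A) k x B.

(* [q] is a version of [x |-> P(E | X = x)]. *)
Definition is_cond_prob (E : set T) (q : TX -> R) : Prop :=
  measurable_fun setT q /\
  forall A, measurable A ->
    P (X @^-1` A `&` E) = \int[distribution P X]_(x in A) (q x)%:E.

Definition cond_independent dU dW (TU : measurableType dU)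
    (TW : measurableType dW) (U : {RV P >-> TU}) (W : {RV P >-> TW}) : Prop :=
  forall A B, measurable A -> measurable B ->
  forall q r : TX -> R,
    is_cond_prob (U @^-1` A) q -> is_cond_prob (W @^-1` B) r ->
    is_cond_prob (U @^-1` A `&` W @^-1` B) (q \* r)%R.

End given.
End conditional_laws.

Section measures.
Context d (T : measurableType d) (R : realType).

(* [f] is a density of [nu] with respect to [mu]. *)
Definition is_density (mu nu : set T -> \bar R) (f : T -> R) : Prop :=
  [/\ measurable_fun setT f, forall x, 0 <= f x &
      forall B, measurable B -> nu B = (\int[mu]_(x in B) (f x)%:E)%E].

(* [m] is a version of [v |-> E[g | W = v]] under [mu]. *)
Definition is_cond_expectation (mu : {measure set T -> \bar R})
    (W : T -> R) (g : T -> R) (m : R -> R) : Prop :=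
  [/\ measurable_fun setT m,
      mu.-integrable setT (EFin \o (m \o W)) &
      forall B, measurable B ->
        (\int[mu]_(u in W @^-1` B) (g u)%:E =
         \int[mu]_(u in W @^-1` B) (m (W u))%:E)%E].

Definition cis (x : R) : R[i] := cos x +i* sin x.

Definition complex_expectation (mu : {measure set T -> \bar R})
    (h : T -> R[i]) : R[i] :=
  Rintegral mu setT (fun u => complex.Re (h u)) +i*
  Rintegral mu setT (fun u => complex.Im (h u)).

End measures.

(* The topological support. *)
Definition msupport (R : realType) (T : topologicalType)
    (mu : set T -> \bar R) : set T :=
  [set x | forall U, open U -> U x -> (0 < mu U)%E].

Definition identifying_class (R : realType) (Phi : set (R -> R)) : Prop :=
  (forall phi, Phi phi ->
     measurable_fun setT phi /\ [bounded phi y | y in [set: R]]) /\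
  (forall nu1 nu2 : {finite_measure set R -> \bar R},
     (forall phi, Phi phi ->
        (\int[nu1]_y (phi y)%:E = \int[nu2]_y (phi y)%:E)%E) ->
     forall B, measurable B -> nu1 B = nu2 B).

Section quasi_analytic.
Context (R : realType) (E : normedModType R) (I : Type) (e : I -> E).

(* Iterated partial derivatives along the vectors [e i] (the canonical basis in
   the sequel); a sequence of indices plays the role of a multi-index. *)
Definition pderivs (s : seq I) (f : E -> R) : E -> R :=
  foldr (fun i g => 'D_(e i) g) f s.

Definition cpderivs (s : seq I) (f : E -> R[i]) (x : E) : R[i] :=
  pderivs s (@complex.Re R \o f) x +i* pderivs s (@complex.Im R \o f) x.

Definition csmooth (f : E -> R[i]) : Prop :=
  forall s x, differentiable (pderivs s (@complex.Re R \o f)) x /\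
              differentiable (pderivs s (@complex.Im R \o f)) x.

(* A control is a family [M] of bounds on the sup-norms of all the derivatives;
   a class may allow several of them, e.g. all the [M s = c * rho ^+ size s *
   m (size s)] with [c] and [rho] arbitrary for a Denjoy-Carleman class. *)
Definition defined_by_controls (C : set (E -> R[i])) : Prop :=
  exists Ms : set (seq I -> R),
    C = [set f | csmooth f /\
           exists2 M, Ms M & forall s x, `|cpderivs s f x| <= (M s)%:C].

Definition quasi_analytic_class (C : set (E -> R[i])) : Prop :=
  defined_by_controls C /\
  forall f g, C f -> C g -> forall x0,
    (forall s, cpderivs s f x0 = cpderivs s g x0) -> f = g.

End quasi_analytic.

(* On R there is one direction of derivation, so [seq unit] indexes the
   derivatives by their order. *)
Definition quasi_analytic_R (R : realType) (C : set (R -> R[i])) : Prop :=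
  quasi_analytic_class (fun _ : unit => 1 : R) C.

Definition quasi_analytic_rV (R : realType) n (C : set ('rV[R]_n -> R[i])) :
    Prop :=
  quasi_analytic_class (fun i : 'I_n => delta_mx ord0 i : 'rV[R]_n) C.

Definition dot (R : realType) n (u v : 'rV[R]_n) : R := (u *m v^T) ord0 ord0.

(* [Sel] is the selection indicator, [Y] being observed only when it is true. *)
Record structure (R : realType) (p n : nat) := Structure {
  disp : measure_display;
  Omega : measurableType disp;
  Pr : probability Omega R;
  Y : {RV Pr >-> R};
  Sel : {RV Pr >-> bool};
  X : {RV Pr >-> 'rV[R]_p};
  V : {RV Pr >-> R};
  Z : {RV Pr >-> 'rV[R]_n};
  Theta : {RV Pr >-> R};
  Gamma : {RV Pr >-> 'rV[R]_n} }.

Section model.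
Context (R : realType) (p n : nat).

Definition observables (S : structure R p n) (w : Omega S) :
    'rV[R]_p * R * 'rV[R]_n * bool * R :=
  (X S w, V S w, Z S w, Sel S w, if Sel S w then Y S w else 0).

Definition observed_law (S : structure R p n) :
    set ('rV[R]_p * R * 'rV[R]_n * bool * R) -> \bar R :=
  pushforward (Pr S) (@observables S).

Definition law_X (S : structure R p n) := distribution (Pr S) (X S).

Definition law_XZ (S : structure R p n) :=
  distribution (Pr S) (rv_pair (X S) (Z S)).

(* Regular versions of the conditional laws of [(Y, Theta, Gamma)] given [X],
   of [V] given [(X, Z)] and of [Z] given [X]; they exist, and are unique up to
   null sets of values of the conditioning variables.  Accordingly, "for all
   [x] in the support of [X]" is read as [law_X]-almost everywhere (so at every
   atom of [law_X]), and "for all [(x, z)]" as [law_XZ]-almost everywhere. *)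
Record cond_laws (S : structure R p n) := CondLaws {
  law_U : R.-pker 'rV[R]_p ~> (R * R * 'rV[R]_n)%type;
  law_V : R.-pker ('rV[R]_p * 'rV[R]_n)%type ~> R;
  law_Z : R.-pker 'rV[R]_p ~> 'rV[R]_n;
  law_UP : is_cond_law (X S) (rv_pair (rv_pair (Y S) (Theta S)) (Gamma S)) law_U;
  law_VP : is_cond_law (rv_pair (X S) (Z S)) (V S) law_V;
  law_ZP : is_cond_law (X S) (Z S) law_Z }.

(* [Y], [(Theta, Gamma)] and [Theta + Gamma^T z] as functions of
   [u = (Y, Theta, Gamma)]. *)
Definition outcome (u : R * R * 'rV[R]_n) : R := u.1.1.
Definition unobs (u : R * R * 'rV[R]_n) : R * 'rV[R]_n := (u.1.2, u.2).
Definition threshold (z : 'rV[R]_n) (u : R * R * 'rV[R]_n) : R :=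
  u.1.2 + dot u.2 z.

Section assumptions.
Context (S : structure R p n) (k : cond_laws S).

Definition selection_equation : Prop :=
  \forall w \ae Pr S,
    Sel S w = (0 < V S w - Theta S w - dot (Gamma S w) (Z S w)).

Definition instrument_independence : Prop :=
  cond_independent (X S) (rv_pair (V S) (Z S))
    (rv_pair (rv_pair (Theta S) (Gamma S)) (Y S)).

Definition densities_exist : Prop :=
  \forall xz \ae law_XZ S,
    (exists f, is_density (lebesgue_measure \x^ @lebesgue_rV R n)%E
                 (pushforward (law_U k xz.1) unobs) f) /\
    (exists f, is_density lebesgue_measure
                 (pushforward (law_U k xz.1) (threshold xz.2)) f).

Definition full_support : Prop :=
  (\forall xz \ae law_XZ S,
     msupport (pushforward (law_U k xz.1) (threshold xz.2)) `<=`
     msupport (law_V k xz)) /\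
  (\forall x \ae law_X S, msupport (law_Z k x) = [set: 'rV[R]_n]).

(* [v |-> E[phi(Y) | Theta + Gamma^T z = v, X = x] f_{Theta + Gamma^T z | X = x}(v)],
   which depends on the versions chosen for its two factors. *)
Definition is_version_a (phi : R -> R) (x : 'rV[R]_p) (z : 'rV[R]_n)
    (a : R -> R) : Prop :=
  exists m f : R -> R,
    [/\ is_cond_expectation (law_U k x) (threshold z) (phi \o outcome) m,
        is_density lebesgue_measure
          (pushforward (law_U k x) (threshold z)) f &
        a = (m \* f)%R].

Definition fun_b (phi : R -> R) (s : R) (x : 'rV[R]_p) (t : 'rV[R]_n) : R[i] :=
  complex_expectation (law_U k x) (fun u =>
    cis (u.1.2 * s) * cis (dot u.2 t * s) * (phi (outcome u))%:C).

Definition quasi_analyticity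
    (Phi : 'rV[R]_p -> set (R -> R))
    (Ca : 'rV[R]_p -> 'rV[R]_n -> set (R -> R[i]))
    (Cb : R -> 'rV[R]_p -> set ('rV[R]_n -> R[i])) : Prop :=
  \forall xz \ae law_XZ S, let x := xz.1 in let z := xz.2 in
    [/\ identifying_class (Phi x),
        quasi_analytic_R (Ca x z) &
        forall s, quasi_analytic_rV (Cb s x)] /\
    [/\ interior (msupport (law_V k xz)) !=set0,
        interior (msupport (law_Z k x)) !=set0 &
        forall phi, Phi x phi ->
          (exists2 a, is_version_a phi x z a & Ca x z (fun v => (a v)%:C)) /\
          (forall s, Cb s x (fun_b phi s x))].

Definition assumptions
    (Phi : 'rV[R]_p -> set (R -> R))
    (Ca : 'rV[R]_p -> 'rV[R]_n -> set (R -> R[i]))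
    (Cb : R -> 'rV[R]_p -> set ('rV[R]_n -> R[i])) : Prop :=
  [/\ selection_equation, instrument_independence, densities_exist &
      full_support \/ quasi_analyticity Phi Ca Cb].

End assumptions.
End model.

(* Main.v *)
(* Conditionally on X = x, the observed data determine
   G_E(v) = P(Y in E, Theta + Gamma^T z < v | X = x) for almost every (z, v), hence,
   G_E being continuous in v, for all v in the support of V.
   If that support contains the support of the threshold Theta + Gamma^T z, then
   G_E is known everywhere: its increments over a gap of the set of agreement
   vanish for one structure, and monotonicity transfers this to the other one.
   In the quasi-analytic case, the integrals of a over the intervals contained in
   the support of V are known, so a is known on an open set, hence everywhere.
   Either way E[phi(Y) e^{is(Theta + Gamma^T z)} | X = x] is known for almost every
   z, hence on the support of Z, hence for all z by density or quasi-analyticity.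
   As z and s vary, these are all the characters of (Theta, Gamma), and bounded
   pointwise limits of trigonometric polynomials include the indicators of products
   of half-lines. *)
Require Import Defs.
From HB Require Import structures.
From mathcomp Require Import all_boot all_order all_algebra.
From mathcomp Require Import complex finmap ring lra.
From mathcomp Require Import all_classical all_reals all_analysis measurable_realfun.

Set Implicit Arguments.
Unset Strict Implicit.
Unset Printing Implicit Defensive.

Import Order.TTheory GRing.Theory Num.Theory.
Import numFieldNormedType.Exports.

Local Open Scope classical_set_scope.
Local Open Scope complex_scope.
Local Open Scope ring_scope.

(** * Bounded limits of trigonometric polynomials *)

(** The weight [phi(Y)] may change sign, so that [phi] times a law is a signed measure. Everything
    is therefore an equality of integrals of bounded functions, which extends from a class of
    functions to its closure [bl_span] under linear combinations and bounded pointwise limits. The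
    passage from characters to half-lines is explicit: polynomials in sine and cosine approximate a
    square wave whose period then grows. The data give equalities outside null sets that depend on
    the event considered, whereas the conclusion needs one null set of [x] for all events. Sets of
    outcomes are reduced to the countably many rational half-lines, and the points [v] and [z] to
    closed sets of agreement, since a closed set of full measure contains the support. Closedness in
    [v] is where the densities enter, through the absence of atoms. In the gap argument the first
    law gives no mass to the points of disagreement, but nothing of the sort is known of the second
    law: this is why the comparison starts from inequalities. *)

Section step_functions.
Context {R : realType}.
Implicit Types t x : R.

Lemma ge_bernoulli x (m : nat) : 0 <= x <= 1 -> 1 - m%:R * x <= (1 - x) ^+ m.
Proof.
move=> /andP[x0 x1]; elim: m => [|m IH]; first by rewrite mul0r subr0 expr0.
rewrite exprS; apply: (@le_trans _ _ ((1 - x) * (1 - m%:R * x))).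
  have : 0 <= m%:R * x * x by rewrite !mulr_ge0.
  by rewrite -natr1; nra.
by rewrite ler_wpM2l// subr_ge0.
Qed.

(** Bernoulli bounds [m x] by [(1 + x) ^+ m], and the product of the two powers is
    [(1 - x ^+ 2) ^+ m]. *)
Lemma le_bernoulli x (m : nat) : 0 <= x <= 1 ->
  (1 - x) ^+ m * (m%:R * x) <= 1.
Proof.
move=> /andP[x0 x1].
have h1 : m%:R * x <= (1 + x) ^+ m.
  elim: m => [|m IH]; first by rewrite mul0r expr0.
  have h : 1 <= (1 + x) ^+ m by rewrite exprn_ege1// lerDl.
  by rewrite exprS -natr1 mulrDl mul1r mulrDl mul1r lerD// ler_peMr.
apply: (@le_trans _ _ ((1 - x) ^+ m * (1 + x) ^+ m)).
  by rewrite ler_wpM2l// exprn_ge0// subr_ge0.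
rewrite -exprMn; apply: exprn_ile1; first by rewrite mulr_ge0; lra.
by rewrite -subr_sqr expr1n gerBl sqr_ge0.
Qed.

(* The Brosowski-Deutsch polynomials of the elementary proof of the
   Stone-Weierstrass theorem. *)
Definition half_step t (n : nat) : R := (1 - t ^+ n) ^+ (2 ^ n).

Lemma half_step_itv t n : 0 <= t <= 1 -> 0 <= half_step t n <= 1.
Proof.
move=> /andP[t0 t1]; have h1 : t ^+ n <= 1 by rewrite exprn_ile1.
have h2 : 0 <= t ^+ n by rewrite exprn_ge0.
by rewrite /half_step exprn_ge0 ?subr_ge0// exprn_ile1// ?subr_ge0// gerBl.
Qed.

(** Bernoulli's inequality bounds [half_step t n] below by [1 - (2 * t) ^+ n]: the exponent [2 ^ n]
    is what places the jump at [1 / 2]. *)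
Lemma cvg_half_step1 t : 0 <= t < 2^-1 -> half_step t n @[n --> \oo] --> (1 : R).
Proof.
move=> /andP[t0 t2].
have t1 : t <= 1 by lra.
apply: (@squeeze_cvgr _ _ _ _ (fun n => 1 - (2 * t) ^+ n) (fun=> 1 : R)).
- near=> n; have /andP[_ ->] := @half_step_itv t n ltac:(by rewrite t0 t1).
  rewrite andbT exprMn -natrX ge_bernoulli//.
  by rewrite exprn_ge0// exprn_ile1.
- rewrite -[X in _ --> X]subr0; apply: cvgB; first exact: cvg_cst.
  by apply: cvg_expr; rewrite ger0_norm; lra.
- exact: cvg_cst.
Unshelve. all: by end_near. Qed.

(** By [le_bernoulli] at [t ^+ n], [half_step t n] is at most the inverse of [(2 * t) ^+ n]. *)
Lemma cvg_half_step0 t : 2^-1 < t <= 1 -> half_step t n @[n --> \oo] --> (0 : R).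
Proof.
move=> /andP[t2 t1].
have t0 : 0 <= t by lra.
apply: (@squeeze_cvgr _ _ _ _ (fun=> 0) (fun n => (2 * t)^-1 ^+ n)).
- near=> n; have /andP[-> _] := @half_step_itv t n ltac:(by rewrite t0 t1).
  rewrite andTb exprVn -[leRHS]mul1r ler_pdivlMr; last first.
    by rewrite exprn_gt0//; lra.
  by rewrite exprMn -natrX le_bernoulli// exprn_ge0// exprn_ile1.
- exact: cvg_cst.
- apply: cvg_expr; rewrite ger0_norm; last by rewrite invr_ge0; lra.
  by rewrite invf_lt1; lra.
Unshelve. all: by end_near. Qed.

(* [half_step] has no useful limit at [1 / 2]; the second factor vanishes there,
   i.e. at [sin u = 0], and tends to [1] elsewhere. *)
Definition sin_step (u : R) (n : nat) : R :=
  half_step ((1 + sin u) / 2) n * (1 - (cos u ^+ 2) ^+ n).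

Lemma sin_step_itv u n : 0 <= sin_step u n <= 1.
Proof.
have s1 := sin_geN1 u; have s2 := sin_le1 u.
have /andP[h1 h2] := @half_step_itv ((1 + sin u) / 2) n ltac:(lra).
have c1 : cos u ^+ 2 <= 1 by rewrite -(cos2Dsin2 u) lerDl sqr_ge0.
have c2 : (cos u ^+ 2) ^+ n <= 1 by rewrite exprn_ile1// sqr_ge0.
have c3 : 0 <= (cos u ^+ 2) ^+ n by rewrite exprn_ge0// sqr_ge0.
by rewrite /sin_step mulr_ge0 ?subr_ge0//= mulr_ile1 ?subr_ge0// gerBl.
Qed.

Lemma cvg_sin_step u :
  sin_step u n @[n --> \oo] --> (((sin u < 0)%R : nat)%:R : R).
Proof.
have s1 := sin_geN1 u; have s2 := sin_le1 u.
have [s0|s0|s0] := ltgtP (sin u) 0.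
- rewrite -[X in _ --> X]mulr1; apply: cvgM; first by apply: cvg_half_step1; move: s1 s0; clear; lra.
  rewrite -[X in _ --> X]subr0; apply: cvgB; first exact: cvg_cst.
  apply: cvg_expr; rewrite ger0_norm ?sqr_ge0// cos2sin2.
  by rewrite ltrBlDr ltrDl exprn_even_gt0//= (lt_eqF s0).
- have -> : (false%:R : R) = 0 * (1 - 0) by rewrite mul0r.
  apply: cvgM; first by apply: cvg_half_step0; move: s2 s0; clear; lra.
  apply: cvgB; first exact: cvg_cst.
  apply: cvg_expr; rewrite ger0_norm ?sqr_ge0// cos2sin2.
  by rewrite ltrBlDr ltrDl exprn_even_gt0//= (gt_eqF s0).
- rewrite (_ : (fun n => _) = fun=> 0); first exact: cvg_cst.
  apply/funext => n; rewrite /sin_step cos2sin2 s0 expr0n/= subr0 expr1n.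
  by rewrite subrr mulr0.
Qed.

(** Dividing by a large integer brings the angle into []-2, 2[], where the sine has the sign of its
    argument; the sequence is eventually constant. *)
Lemma cvg_sin_lt0 (x a : R) :
  (((sin ((x - a) / n.+1%:R) < 0)%R : nat)%:R : R) @[n --> \oo] --> (((x < a)%R : nat)%:R : R).
Proof.
apply: cvg_near_cst; near=> n; congr (nat_of_bool _)%:R.
have n0 : (0:R) < n.+1%:R by rewrite ltr0n.
have h : `|(x - a) / n.+1%:R| < 2.
  rewrite normrM normfV (ger0_norm (ltW n0)) ltr_pdivrMr//.
  apply: (@lt_le_trans _ _ n%:R).
    by near: n; exact: nbhs_infty_gtr.
  by rewrite -natr1; have : (0:R) <= n%:R by []; lra.
have [xa|xa|->] := ltgtP x a; last by rewrite subrr mul0r sin0 ltxx.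
- have m0 : (x - a) / n.+1%:R < 0 by rewrite pmulr_llt0 ?invr_gt0// subr_lt0.
  move: h; rewrite (ltr0_norm m0) => h.
  by rewrite -oppr_gt0 -sinN sin2_gt0// h oppr_gt0 m0.
- have m0 : 0 < (x - a) / n.+1%:R by rewrite divr_gt0// subr_gt0.
  move: h; rewrite (gtr0_norm m0) => h.
  by apply/negbTE; rewrite -leNgt ltW// sin2_gt0// h m0.
Unshelve. all: by end_near. Qed.

End step_functions.

Section bounded_limits.
Context {T : Type} {R : realType}.
Implicit Types (f g : T -> R) (G : set (T -> R)).

(** Inductive because limits have to be iterated: the indicator of a half-line takes two successive
    limits of trigonometric polynomials. Convergence is required at every point, so that the class
    depends on no measure and serves for two laws at once. *)
Inductive bl_span G : (T -> R) -> Prop :=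
| bl_span_base f of G f : bl_span G f
| bl_span_add f g of bl_span G f & bl_span G g : bl_span G (fun x => f x + g x)
| bl_span_scale (c : R) f of bl_span G f : bl_span G (fun x => c * f x)
| bl_span_lim (h : nat -> T -> R) f (M : R) of
    (forall n, bl_span G (h n)) & (forall n x, `|h n x| <= M) &
    (forall x, h n x @[n --> \oo] --> f x) : bl_span G f.

Lemma bl_span_bounded G f : (forall g, G g -> exists M : R, forall x, `|g x| <= M) ->
  bl_span G f -> exists M : R, forall x, `|f x| <= M.
Proof.
move=> GM; elim=> [{}f /GM//|{}f g _ [M1 h1] _ [M2 h2]|c {}f _ [M h]|].
- by exists (M1 + M2) => x; rewrite (le_trans (ler_normD _ _))// lerD.
- by exists (`|c| * M) => x; rewrite normrM ler_wpM2l.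
- move=> h {}f M _ _ hM hf; exists M => x.
  have hfx : `|h n x| @[n --> \oo] --> `|f x| by apply: cvg_norm; exact: hf.
  rewrite -(cvg_lim _ hfx)//; apply: limr_le; first by apply/cvg_ex; exists `|f x|.
  by apply: nearW => n; exact: hM.
Qed.

(** Induction on [f], then on [g] when [f] is a generator. The bound on the fixed factor keeps the
    products of a bounded sequence bounded. *)
Lemma bl_span_mul G f g : (forall g, G g -> exists M : R, forall x, `|g x| <= M) ->
  (forall f g, G f -> G g -> bl_span G (fun x => f x * g x)) ->
  bl_span G f -> bl_span G g -> bl_span G (fun x => f x * g x).
Proof.
move=> GM GG Hf Hg; have [Mg gM] := bl_span_bounded GM Hg.
elim: Hf => [{}f Gf|f1 f2 _ h1 _ h2|c {}f _ h|h {}f M hh hg hM hf].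
- elim: Hg {Mg gM} => [{}g|g1 g2 _ h1 _ h2|c {}g _ h|h {}g M hh hg hM hf].
  + exact: GG.
  + under eq_fun do rewrite mulrDr; exact: bl_span_add.
  + under eq_fun do rewrite mulrCA; exact: bl_span_scale.
  + have [Mf fM] := GM _ Gf.
    apply: (@bl_span_lim _ (fun n x => f x * h n x) _ (Mf * M)) => // n x.
      by rewrite normrM ler_pM.
    exact: cvgMr.
- under eq_fun do rewrite mulrDl; exact: bl_span_add.
- under eq_fun do rewrite -mulrA; exact: bl_span_scale.
- apply: (@bl_span_lim _ (fun n x => h n x * g x) _ (M * Mg)) => // n x.
    by rewrite normrM ler_pM.
  exact: cvgMl.
Qed.

Definition trig (L : set (T -> R)) : set (T -> R) :=
  [set f | exists2 l, L l & f = (fun x => cos (l x)) \/ f = (fun x => sin (l x))].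

Section trig.
Variable L : set (T -> R).
Hypothesis L0 : L (fun=> 0).
Hypothesis Ladd : forall c f g, L f -> L g -> L (fun x => c * f x + g x).

Lemma trig_bounded g : trig L g -> exists M : R, forall x, `|g x| <= M.
Proof.
by move=> [l _ [->|->]]; exists 1 => x; [exact: cos_max|exact: sin_max].
Qed.

Let cosL l : L l -> bl_span (trig L) (fun x => cos (l x)).
Proof. by move=> Ll; apply: bl_span_base; exists l => //; left. Qed.

Let sinL l : L l -> bl_span (trig L) (fun x => sin (l x)).
Proof. by move=> Ll; apply: bl_span_base; exists l => //; right. Qed.

Let LD f g : L f -> L g -> L (fun x => f x + g x).
Proof.
by move=> Lf Lg; have := Ladd 1 Lf Lg; under eq_fun do rewrite mul1r.
Qed.

Let LB f g : L f -> L g -> L (fun x => f x - g x).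
Proof.
move=> Lf Lg; have := Ladd (-1) Lg Lf.
by under eq_fun do rewrite mulN1r addrC.
Qed.

Let LZ c f : L f -> L (fun x => c * f x).
Proof. by move=> Lf; have := Ladd c Lf L0; under eq_fun do rewrite addr0. Qed.

(** The product-to-sum formulas, which stay in the class because [L] is stable under sums and
    differences. *)
Lemma trig_mul f g : trig L f -> trig L g ->
  bl_span (trig L) (fun x => f x * g x).
Proof.
move=> [l Ll fE] [l' Ll' gE].
have cD := cosL (LD Ll Ll'); have cB := cosL (LB Ll Ll').
have sD := sinL (LD Ll Ll'); have sB := sinL (LB Ll Ll').
case: fE gE => -> [] ->.
- have := bl_span_scale 2^-1 (bl_span_add cB cD).
  by congr bl_span; apply/funext => x; rewrite ?(sinB, sinD, cosB, cosD); field.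
- have := bl_span_scale 2^-1 (bl_span_add sD (bl_span_scale (-1) sB)).
  by congr bl_span; apply/funext => x; rewrite ?(sinB, sinD, cosB, cosD); field.
- have := bl_span_scale 2^-1 (bl_span_add sD sB).
  by congr bl_span; apply/funext => x; rewrite ?(sinB, sinD, cosB, cosD); field.
- have := bl_span_scale 2^-1 (bl_span_add cB (bl_span_scale (-1) cD)).
  by congr bl_span; apply/funext => x; rewrite ?(sinB, sinD, cosB, cosD); field.
Qed.

Lemma bl_span_trig_mul f g : bl_span (trig L) f -> bl_span (trig L) g ->
  bl_span (trig L) (fun x => f x * g x).
Proof. by apply: bl_span_mul; [exact: trig_bounded|exact: trig_mul]. Qed.

Lemma bl_span_trig_cst c : bl_span (trig L) (fun=> c).
Proof.
by have := bl_span_scale c (cosL L0); under eq_fun do rewrite cos0 mulr1.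
Qed.

Lemma bl_span_trigX f n : bl_span (trig L) f -> bl_span (trig L) (fun x => f x ^+ n).
Proof.
move=> Lf; elim: n => [|n IH].
  by under eq_fun do rewrite expr0; exact: bl_span_trig_cst.
by under eq_fun do rewrite exprS; exact: bl_span_trig_mul.
Qed.

Let cos_aff l c : L l -> bl_span (trig L) (fun x => cos (l x - c)).
Proof.
move=> Ll; under eq_fun do rewrite cosB; apply: bl_span_add;
  apply: bl_span_trig_mul => //; solve [exact: cosL|exact: sinL|exact: bl_span_trig_cst].
Qed.

Let sin_aff l c : L l -> bl_span (trig L) (fun x => sin (l x - c)).
Proof.
move=> Ll; under eq_fun do rewrite sinB -mulN1r.
apply: bl_span_add; last apply: bl_span_scale;
  apply: bl_span_trig_mul => //; solve [exact: cosL|exact: sinL|exact: bl_span_trig_cst].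
Qed.

Let one_sub f : bl_span (trig L) f -> bl_span (trig L) (fun x => 1 - f x).
Proof.
move=> Lf; under eq_fun do rewrite -mulN1r.
by apply: bl_span_add; [exact: bl_span_trig_cst|exact: bl_span_scale].
Qed.

(** Two limits: at fixed [n], polynomials in the sine and cosine of [u n x] tend to the indicator of
    [sin (u n x) < 0], which tends in turn to that of [l x < a]. *)
Lemma bl_span_trig_lt l a : L l ->
  bl_span (trig L) (fun x => ((l x < a)%R : nat)%:R).
Proof.
move=> Ll; pose u n x := (l x - a) / n.+1%:R.
have su n : bl_span (trig L) (fun x => sin (u n x)).
  rewrite /u; under eq_fun do rewrite mulrBl mulrC.
  by apply: (@sin_aff (fun x => _ * l x)); exact: LZ.
have cu n : bl_span (trig L) (fun x => cos (u n x)).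
  rewrite /u; under eq_fun do rewrite mulrBl mulrC.
  by apply: (@cos_aff (fun x => _ * l x)); exact: LZ.
apply: (@bl_span_lim _ (fun n x => ((sin (u n x) < 0)%R : nat)%:R) _ 1).
- move=> n; apply: (@bl_span_lim _ (fun m x => sin_step (u n x) m) _ 1).
  + move=> m; apply: bl_span_trig_mul; last first.
      by apply: one_sub; do 2 apply: bl_span_trigX.
    apply: bl_span_trigX; apply: one_sub; apply: bl_span_trigX.
    apply: bl_span_trig_mul; last exact: bl_span_trig_cst.
    by apply: bl_span_add => //; exact: bl_span_trig_cst.
  + by move=> m x; have /andP[? ?] := sin_step_itv (u n x) m; rewrite ger0_norm.
  + by move=> x; exact: cvg_sin_step.
- by move=> n x; case: (_ < _); rewrite ?normr1 ?normr0.
- by move=> x; exact: cvg_sin_lt0.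
Qed.

End trig.
End bounded_limits.

(** * Integrals of bounded measurable functions *)

Import HBNNSimple.

Section bounded_integrals.
Context d (T : measurableType d) {R : realType}.
Implicit Types (f g phi : T -> R) (mu : {measure set T -> \bar R}).

Definition bounded_measurable f :=
  measurable_fun setT f /\ exists M : R, forall x, `|f x| <= M.

Lemma bounded_measurable_integrable mu f : (mu setT < +oo)%E ->
  bounded_measurable f -> mu.-integrable setT (EFin \o f).
Proof.
move=> muT [mf [M fM]]; apply: measurable_bounded_integrable => //.
by exists M; split; [exact: num_real|move=> N MN x _; exact: le_trans (ltW MN)].
Qed.

Lemma bounded_measurableM f g : bounded_measurable f -> bounded_measurable g ->
  bounded_measurable (fun x => f x * g x).
Proof.
move=> [mf [M fM]] [mg [N gN]]; split; first exact: measurable_funM.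
by exists (M * N) => x; rewrite normrM ler_pM.
Qed.

Lemma bounded_measurable_indic (A : set T) : measurable A ->
  bounded_measurable (\1_A : T -> R).
Proof.
move=> mA; split; first exact: measurable_indic.
by exists 1 => x; rewrite indicE; case: (_ \in _); rewrite ?normr1 ?normr0.
Qed.

Lemma bounded_cvg_Rintegral mu (h : nat -> T -> R) f (M : R) :
  (mu setT < +oo)%E ->
  (forall n, measurable_fun setT (h n)) -> (forall n x, `|h n x| <= M) ->
  (forall x, h n x @[n --> \oo] --> f x) ->
  \int[mu]_x h n x @[n --> \oo] --> \int[mu]_x f x.
Proof.
move=> muT mh hM hf.
have mf : measurable_fun setT f by apply: (measurable_fun_cvg mh) => x _; exact: hf.
have fM x : `|f x| <= M.
  have hfx : `|h n x| @[n --> \oo] --> `|f x| by apply: cvg_norm; exact: hf.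
  rewrite -(cvg_lim _ hfx)//; apply: limr_le; first by apply/cvg_ex; exists `|f x|.
  by apply: nearW => n; exact: hM.
have iM : mu.-integrable setT (EFin \o cst M : T -> \bar R).
  by apply: bounded_measurable_integrable => //; split => //; exists `|M|.
have [if_ _ cv] := @dominated_convergence _ T R mu setT measurableT
  (fun n x => (h n x)%:E) (EFin \o f) (EFin \o cst M)
  ltac:(by move=> n; apply/measurable_EFinP)
  ltac:(by apply/measurable_EFinP)
  ltac:(by apply: aeW => x _ /=; apply: cvg_EFin; [exact: nearW|exact: hf])
  iM
  ltac:(by apply: aeW => x n _; rewrite /= lee_fin).
have fin : (\int[mu]_x (f x)%:E)%E \is a fin_num by apply: integrable_fin_num.
have := cv; rewrite -[X in _ --> X](fineK fin) => cv'.
exact: fine_cvg cv'.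
Qed.

Section bl_span_Rintegral.
Variables (mu1 mu2 : {measure set T -> \bar R}) (phi : T -> R).
Hypotheses (mu1T : (mu1 setT < +oo)%E) (mu2T : (mu2 setT < +oo)%E).
Hypothesis bphi : bounded_measurable phi.

(** Keeping the weight [phi] inside the integral avoids signed measures. Boundedness and
    measurability are carried through the induction because linearity and dominated convergence use
    them at each step. *)
Lemma bl_span_Rintegral (G : set (T -> R)) :
  (forall g, G g -> bounded_measurable g) ->
  (forall g, G g -> \int[mu1]_x (phi x * g x) = \int[mu2]_x (phi x * g x)) ->
  forall f, bl_span G f -> bounded_measurable f /\
    \int[mu1]_x (phi x * f x) = \int[mu2]_x (phi x * f x).
Proof.
move=> Gb GE f; elim=> {f} [g Gg|f g _ [bf IHf] _ [bg IHg]|c f _ [bf IHf]|].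
- by split; [exact: Gb|exact: GE].
- split.
    move: bf bg => [mf [M fM]] [mg [N gN]]; split; first exact: measurable_funD.
    by exists (M + N) => x; rewrite (le_trans (ler_normD _ _))// lerD.
  under eq_Rintegral do rewrite mulrDr; under [RHS]eq_Rintegral do rewrite mulrDr.
  by rewrite !RintegralD//; [rewrite IHf IHg|
    apply: bounded_measurable_integrable => //; exact: bounded_measurableM..].
- split.
    move: bf => [mf [M fM]]; split; first exact: measurable_funM.
    by exists (`|c| * M) => x; rewrite normrM ler_wpM2l.
  under eq_Rintegral do rewrite mulrCA; under [RHS]eq_Rintegral do rewrite mulrCA.
  by rewrite !RintegralZl//; [rewrite IHf|
    apply: bounded_measurable_integrable => //; exact: bounded_measurableM..].
- move=> h f M _ IH hM hf; split.
    split; first by apply: (@measurable_fun_cvg _ _ _ _ h) => [n|x _];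
      [case: (IH n) => -[]|exact: hf].
    exists M => x.
    have hfx : `|h n x| @[n --> \oo] --> `|f x| by apply: cvg_norm; exact: hf.
    rewrite -(cvg_lim _ hfx)//; apply: limr_le; first by apply/cvg_ex; exists `|f x|.
    by apply: nearW => n; exact: hM.
  have [mphi [N phiN]] := bphi.
  have cv mu : (mu setT < +oo)%E ->
    \int[mu]_x (phi x * h n x) @[n --> \oo] --> \int[mu]_x (phi x * f x).
    move=> muT; apply: (@bounded_cvg_Rintegral _ _ _ (N * M)) => //.
    - by move=> n; apply: measurable_funM => //; case: (IH n) => -[].
    - by move=> n x; rewrite normrM ler_pM.
    - by move=> x; exact: cvgMr.
  have c1 := cv _ mu1T; have c2 := cv _ mu2T.
  have E : (fun n => \int[mu1]_x (phi x * h n x)) =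
           (fun n => \int[mu2]_x (phi x * h n x)).
    by apply/funext => n; case: (IH n).
  by rewrite E in c1; exact: cvg_unique c1 c2.
Qed.

End bl_span_Rintegral.

Definition indics : set (T -> R) := [set g | exists2 A, measurable A & g = \1_A].

(** Simple functions are finite combinations of indicators, nonnegative functions are limits of
    simple ones, and [f] is [f + M] minus a constant, where [f + M] is nonnegative. *)
Lemma bl_span_indics f : bounded_measurable f -> bl_span indics f.
Proof.
have C c : bl_span indics (cst c).
  have := bl_span_scale c (@bl_span_base _ _ indics (\1_setT) ltac:(by exists setT)).
  by congr bl_span; apply/funext => x; rewrite indicT mulr1.
have S (g : {nnsfun T >-> R}) : bl_span indics g.
  rewrite (_ : (g : T -> R) = fun x => \sum_(i < size (fset_set (range g)))
     ((fset_set (range g))`_i * \1_(g @^-1` [set (fset_set (range g))`_i]) x)); last first.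
    by apply/funext => x; rewrite fimfunEord.
  elim: (size _) => [|n IH]; first by under eq_fun do rewrite big_ord0; exact: C.
  under eq_fun do rewrite big_ord_recr /=; apply: bl_span_add => //.
  apply: bl_span_scale; apply: bl_span_base; eexists; last by [].
  by have := measurable_funP g measurableT [set (fset_set (range g))`_n];
    rewrite setTI; exact.
have P g : bounded_measurable g -> (forall x, 0 <= g x) -> bl_span indics g.
  move=> [mg [M gM]] g0.
  have mg' : measurable_fun setT (EFin \o g) by exact/measurable_EFinP.
  have cv x : nnsfun_approx measurableT mg' n x @[n --> \oo] --> g x.
    have g0' y : setT y -> (0 <= (EFin \o g) y)%E by rewrite lee_fin.
    exact: (fine_cvg (cvg_nnsfun_approx measurableT mg' g0' (x := x) I)).
  apply: (@bl_span_lim _ _ _ (nnsfun_approx measurableT mg') _ M) => // n x.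
  (* The approximations increase to [g], hence share its bound. *)
  rewrite ger0_norm//; apply: le_trans (le_trans (ler_norm _) (gM x)).
  rewrite -(cvg_lim _ (cv x))//; apply: nondecreasing_cvgn_le.
    by move=> m p mp; move/lefP: (nd_nnsfun_approx measurableT mg' mp); apply.
  by apply/cvg_ex; exists (g x).
move=> bf; have [mf [M fM]] := bf.
have := bl_span_add (C (- M)) (P (fun x => f x + M) _ _).
rewrite (_ : (fun x => cst (- M) x + _) = f); last first.
  by apply/funext => x /=; rewrite addrCA addNr addr0.
apply.
- split; first exact: measurable_funD.
  by exists (M + M) => x; rewrite (le_trans (ler_normD _ _))// lerD// ger0_norm//
    (le_trans _ (fM x)).
- by move=> x; have := fM x; rewrite ler_norml => /andP[? _]; rewrite -lerBlDr sub0r.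
Qed.

End bounded_integrals.

Lemma bl_span_comp {T T' : Type} {R : realType} (w : T' -> T) (G : set (T -> R)) f :
  bl_span G f -> bl_span [set g \o w | g in G] (f \o w).
Proof.
elim=> {f} [f Gf|f g _ h1 _ h2|c f _ h|h f M _ hh hM hf].
- by apply: bl_span_base; exists f.
- exact: bl_span_add.
- exact: bl_span_scale.
- by apply: (@bl_span_lim _ _ _ (fun n => h n \o w) _ M) => [//|n x|x]; [exact: hM|exact: hf].
Qed.

(** Reduces a bounded function of [w] to indicators while leaving the weight untouched. It is used
    both with a function of the outcome as weight and the threshold as [w], and the other way
    round. *)
Lemma eq_Rintegral_indic_comp d (T : measurableType d) {R : realType}
    (mu1 mu2 : {measure set T -> \bar R}) (phi : T -> R)
    d' (T' : measurableType d') (w : T -> T') (f : T' -> R) :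
  (mu1 setT < +oo)%E -> (mu2 setT < +oo)%E -> bounded_measurable phi ->
  measurable_fun setT w -> bounded_measurable f ->
  (forall A, measurable A ->
    \int[mu1]_x (phi x * \1_A (w x)) = \int[mu2]_x (phi x * \1_A (w x))) ->
  \int[mu1]_x (phi x * f (w x)) = \int[mu2]_x (phi x * f (w x)).
Proof.
move=> h1 h2 bphi mw /bl_span_indics/(bl_span_comp w) Hf HA.
apply: (proj2 (@bl_span_Rintegral _ _ _ mu1 mu2 phi h1 h2 bphi _ _ _ _ Hf)).
- move=> _ [_ [A mA ->] <-]; split.
    have [mI _] := @bounded_measurable_indic _ _ R A mA; exact: measurableT_comp mI mw.
  by exists 1 => x /=; rewrite indicE; case: (_ \in _); rewrite ?normr1 ?normr0.
- by move=> _ [_ [A mA ->] <-]; exact: HA.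
Qed.

(** * Laws of (Y, Theta, Gamma) *)

Section row_vectors.
Context {R : realType} {n : nat}.

Lemma measurable_coor (i : 'I_n) :
  measurable_fun setT (fun v : 'rV[R]_n => v ord0 i).
Proof. by have /measurable_fun_rVP := @measurable_id _ 'rV[R]_n setT. Qed.

(** The sigma-algebra is generated by the coordinates, so open sets have to be related to it: each
    is the union of the countably many rational boxes that it contains. *)
Lemma measurable_open_rV (U : set 'rV[R]_n) : open U -> measurable U.
Proof.
move=> oU.
pose box (c : 'rV[rat]_n * nat) : set 'rV[R]_n :=
  \bigcap_(i in [set: 'I_n]) [set v | `|v ord0 i - ratr (c.1 ord0 i)| < c.2.+1%:R^-1].
pose F c := if `[< box c `<=` U >] then box c else set0.
have -> : U = \bigcup_c F c.
  apply/seteqP; split => [v Uv|v [c _]]; last by rewrite /F; case: asboolP => // cU /cU.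
  have /nbhs_ballP[e /= e0 eU] : nbhs v U by exact: open_nbhs_nbhs.
  (* Half of [e] for the distance from [v] to the centre of the box, half for that from the centre
     to [w]. *)
  have [k ke] : exists k, k.+1%:R^-1 < e / 2.
    have [k] := @ltr_add_invr R 0 (e / 2) ltac:(by rewrite divr_gt0).
    by rewrite add0r => ke; exists k.
  have k0 : (0 : R) < k.+1%:R^-1 by rewrite invr_gt0.
  have /choice[q qv] : forall i : 'I_n, exists q : rat,
      `|v ord0 i - ratr q| < k.+1%:R^-1.
    move=> i; have [q] := @rat_in_itvoo R (v ord0 i - k.+1%:R^-1) (v ord0 i + k.+1%:R^-1)
      ltac:(by rewrite ltrD2l (lt_trans _ k0)// oppr_lt0).
    by rewrite in_itv/= => qi; exists q; rewrite distrC ltr_distl.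
  exists (\row_i q i, k) => //; rewrite /F; case: asboolP => [_|].
    by move=> i _ /=; rewrite mxE.
  case=> w wb; apply: eU; split=> // i j; rewrite (ord1 i).
  have := wb j I; rewrite /= mxE /ball/= => wj; have vj := qv j.
  rewrite (le_lt_trans (ler_distD (ratr (q j)) _ _))//.
  by rewrite (splitr e) ltrD// ?(lt_trans vj)// distrC (lt_trans wj).
apply: countable_bigcupT_measurable; first exact: countableP.
move=> c; rewrite /F; case: asboolP => // _.
apply: fin_bigcap_measurable => // i _.
have mf : measurable_fun setT (fun v : 'rV[R]_n => `|v ord0 i - ratr (c.1 ord0 i)|).
  apply: measurableT_comp => //; apply: measurable_funB => //; exact: measurable_coor.
rewrite -[X in measurable X]setTI.
have := mf measurableT [set` `]-oo, c.2.+1%:R^-1[] (measurable_itv _).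
by rewrite preimage_itvNyo.
Qed.

Lemma dotE (u v : 'rV[R]_n) : dot u v = \sum_i u ord0 i * v ord0 i.
Proof. by rewrite /dot mxE; apply: eq_bigr => i _; rewrite mxE. Qed.

Lemma measurable_dot d (T : measurableType d) (f g : T -> 'rV[R]_n) :
  measurable_fun setT f -> measurable_fun setT g ->
  measurable_fun setT (fun t => dot (f t) (g t)).
Proof.
move=> /measurable_fun_rVP mf /measurable_fun_rVP mg.
under eq_fun do rewrite dotE.
by apply: measurable_sum => i; exact: measurable_funM.
Qed.

End row_vectors.

Section latent.
Context {R : realType} {n : nat}.
Local Notation U := (R * R * 'rV[R]_n)%type.

Lemma measurable_outcome : measurable_fun setT (@outcome R n).
Proof. exact: measurableT_comp measurable_fst measurable_fst. Qed.

Lemma measurable_theta : measurable_fun setT (fun u : U => u.1.2).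
Proof. exact: measurableT_comp measurable_snd measurable_fst. Qed.

Lemma measurable_gamma : measurable_fun setT (fun u : U => u.2).
Proof. exact: measurable_snd. Qed.

Lemma measurable_threshold2 :
  measurable_fun setT (fun zu : 'rV[R]_n * U => threshold zu.1 zu.2).
Proof.
apply: measurable_funD.
  exact: measurableT_comp measurable_theta measurable_snd.
apply: measurable_dot => //.
exact: measurableT_comp measurable_gamma measurable_snd.
Qed.

Lemma measurable_threshold z : measurable_fun setT (@threshold R n z).
Proof. exact: measurable_fun_pair2 z measurable_threshold2. Qed.

Definition ray (a : R) (b : 'rV[R]_n) : set U :=
  [set u : U | u.1.2 < a /\ forall i, u.2 ord0 i < b ord0 i].

Lemma rayE a b (u : U) : \1_(ray a b) u =
  ((u.1.2 < a)%R : nat)%:R * \prod_(i < n) ((u.2 ord0 i < b ord0 i)%R : nat)%:R :> R.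
Proof.
rewrite indicE; have [ua|ua] := boolP (u.1.2 < a)%R; last first.
  by rewrite mul0r memNset// => -[h _]; rewrite h in ua.
rewrite mul1r; have [ub|/forallPn[i ubi]] := boolP [forall i, (u.2 ord0 i < b ord0 i)%R].
  rewrite mem_set; last by split=> // i; exact: (forallP ub).
  by rewrite big1// => i _; rewrite (forallP ub).
by rewrite (bigD1 i)//= (negbTE ubi) mul0r memNset// => -[_ /(_ i) h]; rewrite h in ubi.
Qed.

Lemma ray_bound (u : U) : exists k : nat,
  u.1.2 < k%:R /\ forall i, u.2 ord0 i < k%:R.
Proof.
pose m : R := `|u.1.2| + \sum_i `|u.2 ord0 i|.
have m0 : 0 <= \sum_i `|u.2 ord0 i| by apply: sumr_ge0.
exists (Num.bound m); have mlt : m < (Num.bound m)%:R.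
  by apply: archi_boundP; rewrite /m addr_ge0.
split=> [|i]; apply: le_lt_trans mlt; rewrite /m.
  by rewrite (le_trans (ler_norm _))// lerDl.
rewrite (bigD1 i)//= (le_trans (ler_norm _))// addrCA lerDl addr_ge0//.
exact: sumr_ge0.
Qed.

(** A condition on one coordinate alone does not define a ray; cut by large rays, it becomes a
    countable union of sets of the form used below. *)
Lemma bigcup_ray (A : set U) : A = \bigcup_(k : nat) (A `&` ray k%:R (const_mx k%:R)).
Proof.
rewrite -setI_bigcupr; apply/esym/setIidPl => u _.
by have [k [h1 h2]] := ray_bound u; exists k => //; split=> // i; rewrite mxE.
Qed.

Let rays : set (set U) :=
  [set A | exists B ab, measurable B /\ A = (@outcome R n) @^-1` B `&` ray ab.1 ab.2].

Let measurable_generated_rays : measurable `<=` <<s rays >>.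
Proof.
(* The claim is the measurability of the identity from [TG], which is [U] with the sigma-algebra
   generated by [rays]; it is checked on each coordinate. *)
pose TG : measurableType _ := g_sigma_algebraType rays.
have sub A : rays A -> measurable (A : set TG) by exact: sub_sigma_algebra.
have m1 : measurable_fun setT (fun u : TG => (u : U).1.1).
  move=> _ B mB; rewrite setTI [X in measurable X]bigcup_ray.
  apply: bigcupT_measurable => k; apply: sub.
  by exists B, (k%:R, const_mx k%:R).
have lt_measurable (f : TG -> R) :
    (forall a, measurable [set u : TG | f u < a]) -> measurable_fun setT f.
  move=> h; apply: (measurability _ (RGenInftyO.measurableE R)).
  by move=> _ [_ [a ->] <-]; rewrite setTI preimage_itvNyo; exact: h.
have m2 : measurable_fun setT (fun u : TG => (u : U).1.2).
  apply: lt_measurable => a; rewrite [X in measurable X]bigcup_ray.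
  apply: bigcupT_measurable => k.
  have -> : [set u : TG | (u : U).1.2 < a] `&` ray k%:R (const_mx k%:R) =
      (@outcome R n) @^-1` setT `&` ray (Num.min a k%:R) (const_mx k%:R).
    apply/seteqP; split=> [u [/= h1 [h2 h3]]|u [/= _ [h1 h2]]].
      by split => //; split => //; rewrite lt_min h1.
    by move: h1; rewrite lt_min => /andP[].
  by apply: sub; exists setT, (Num.min a k%:R, const_mx k%:R).
have m3 : measurable_fun setT (fun u : TG => (u : U).2).
  apply/measurable_fun_rVP => i; apply: lt_measurable => a.
  rewrite [X in measurable X]bigcup_ray; apply: bigcupT_measurable => k.
  pose b : 'rV[R]_n := \row_j if j == i then Num.min a k%:R else k%:R.
  have -> : [set u : TG | (u : U).2 ord0 i < a] `&` ray k%:R (const_mx k%:R) =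
      (@outcome R n) @^-1` setT `&` ray k%:R b.
    apply/seteqP; split=> [u [/= h1 [h2 h3]]|u [/= _ [h1 h2]]].
      split => //; split => // j; have := h3 j; rewrite !mxE.
      by case: eqP => [->|//]; rewrite lt_min h1.
    have := h2 i; rewrite mxE eqxx lt_min => /andP[-> _]; split=> //; split=> // j.
    by have := h2 j; rewrite !mxE; case: eqP => // _; rewrite lt_min => /andP[].
  by apply: sub; exists setT, (k%:R, b).
have mid : measurable_fun setT (fun u : TG => (((u : U).1.1, (u : U).1.2), (u : U).2)).
  by apply: measurable_fun_pair => //; exact: measurable_fun_pair.
move=> A mA; have := mid measurableT A mA; rewrite setTI.
by congr (measurable _); apply/seteqP; split=> -[[? ?] ?].
Qed.

Lemma measurable_ray a b : measurable (ray a b).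
Proof.
have -> : ray a b = (fun u : U => u.1.2) @^-1` `]-oo, a[ `&`
    \bigcap_(i in [set: 'I_n]) ((fun u : U => u.2 ord0 i) @^-1` `]-oo, b ord0 i[).
  apply/seteqP; split=> u; rewrite /ray /= in_itv/=.
    by move=> [h1 h2]; split=> // i _ /=; rewrite in_itv/=; exact: h2.
  by move=> [h1 h2]; split=> // i; have := h2 i I; rewrite /= in_itv.
apply: measurableI.
  by rewrite -[X in measurable X]setTI; exact: measurable_theta.
apply: fin_bigcap_measurable => // i _; rewrite -[X in measurable X]setTI.
apply: (measurableT_comp (measurable_coor i) measurable_gamma) => //.
Qed.

Lemma eq_measure_rays (mu1 mu2 : {measure set U -> \bar R}) :
  (mu1 setT < +oo)%E ->
  (forall B a b, measurable B ->
    mu1 ((@outcome R n) @^-1` B `&` ray a b) = mu2 ((@outcome R n) @^-1` B `&` ray a b)) ->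
  forall A, measurable A -> mu1 A = mu2 A.
Proof.
move=> mu1T h A mA.
have raysm : rays `<=` measurable.
  move=> _ [B [[a b] [mB ->]]]; apply: measurableI; last exact: measurable_ray.
  by rewrite -[X in measurable X]setTI; exact: measurable_outcome.
apply: (g_sigma_algebra_measure_unique rays raysm (fun k => ray k%:R (const_mx k%:R))).
- by move=> k; exists setT, (k%:R, const_mx k%:R); split => //; rewrite preimage_setT setTI.
- by rewrite [RHS]bigcup_ray; apply: eq_bigcupr => k _; rewrite setTI.
- move=> _ _ [B [[a b] [mB ->]]] [B' [[a' b'] [mB' ->]]].
  exists (B `&` B'), (Num.min a a', \row_i Num.min (b ord0 i) (b' ord0 i)); split.
    exact: measurableI.
  apply/seteqP; split=> [u [[/= h1 [h2 h3]] [/= h4 [h5 h6]]]|u [/= [h1 h2] [h3 h4]]].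
    by split=> //; split=> /= [|i]; rewrite ?mxE lt_min ?h2 ?h3 ?h5 ?h6.
  move: h3; rewrite lt_min => /andP[h3 h3'].
  by split; (split=> //; split=> // i; have := h4 i; rewrite mxE lt_min => /andP[]).
- by move=> _ [B [[a b] [mB ->]]]; exact: h.
- move=> k; apply: le_lt_trans mu1T; apply: le_measure => //; rewrite ?inE//.
  exact: measurable_ray.
- exact: measurable_generated_rays.
Qed.

(** A ray is a product of half-lines for the coordinate forms, so its indicator lies in the span of
    the characters. This plays the role of the uniqueness of characteristic functions, for the
    possibly signed measures with density [phi]. *)
Lemma eq_trig_eq_ray (mu1 mu2 : {measure set U -> \bar R}) (phi : U -> R) :
  (mu1 setT < +oo)%E -> (mu2 setT < +oo)%E -> bounded_measurable phi ->
  (forall s (xi : 'rV[R]_n), let l (u : U) := s * u.1.2 + dot u.2 xi in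
    \int[mu1]_u (phi u * cos (l u)) = \int[mu2]_u (phi u * cos (l u)) /\
    \int[mu1]_u (phi u * sin (l u)) = \int[mu2]_u (phi u * sin (l u))) ->
  forall a b, \int[mu1]_u (phi u * \1_(ray a b) u) = \int[mu2]_u (phi u * \1_(ray a b) u).
Proof.
move=> mu1T mu2T bphi H a b.
pose L : set (U -> R) :=
  [set l | exists s xi, l = (fun u : U => s * u.1.2 + dot u.2 xi)].
have L0 : L (fun=> 0).
  exists 0, 0; apply/funext => u; rewrite mul0r add0r dotE big1// => i _.
  by rewrite mxE mulr0.
have LD c f g : L f -> L g -> L (fun x => c * f x + g x).
  move=> [s [xi ->]] [s' [xi' ->]]; exists (c * s + s'), (c *: xi + xi').
  apply/funext => u; rewrite !dotE mulrDr mulr_sumr mulrDl -mulrA addrACA; congr (_ + _).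
  by rewrite -big_split/=; apply: eq_bigr => i _; rewrite !mxE; ring.
have Lth : L (fun u => u.1.2).
  exists 1, 0; apply/funext => u; rewrite mul1r dotE big1 ?addr0// => i _.
  by rewrite mxE mulr0.
have Lga i : L (fun u => u.2 ord0 i).
  exists 0, (delta_mx ord0 i); apply/funext => u; rewrite mul0r add0r dotE (bigD1 i)//=.
  rewrite mxE !eqxx mulr1 big1 ?addr0// => j /negbTE ji.
  by rewrite mxE ji andbF mulr0.
have sr : bl_span (trig L) (\1_(ray a b)).
  rewrite (_ : \1_(ray a b) = (fun u : U => ((u.1.2 < a)%R : nat)%:R *
     \prod_(i < n) ((u.2 ord0 i < b ord0 i)%R : nat)%:R)); last first.
    by apply/funext => u; exact: rayE.
  apply: bl_span_trig_mul => //; first exact: (bl_span_trig_lt L0 LD a Lth).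
  elim: (index_enum _) => [|i r IH].
    by under eq_fun do rewrite big_nil; exact: bl_span_trig_cst.
  under eq_fun do rewrite big_cons; apply: bl_span_trig_mul => //.
  exact: (bl_span_trig_lt L0 LD _ (Lga i)).
have mL l : L l -> measurable_fun setT l.
  move=> [s [xi ->]]; apply: measurable_funD.
    by apply: measurable_funM => //; exact: measurable_theta.
  by apply: measurable_dot => //; exact: measurable_gamma.
apply: (proj2 (bl_span_Rintegral mu1T mu2T bphi _ _ sr)).
- move=> _ [l Ll [->|->]]; split.
  + exact: measurableT_comp (continuous_measurable_fun (@continuous_cos R)) (mL _ Ll).
  + by exists 1 => x; exact: cos_max.
  + exact: measurableT_comp (continuous_measurable_fun (@continuous_sin R)) (mL _ Ll).
  + by exists 1 => x; exact: sin_max.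
- by move=> _ [l [s [xi ->]] [->|->]]; have [h1 h2] := H s xi.
Qed.

End latent.

(** * Mixtures and conditional laws *)

Section product_uniqueness.
Context d1 d2 d3 (T1 : measurableType d1) (T2 : measurableType d2)
  (T3 : measurableType d3) (R : realType).

Lemma eq_measure_prod (m1 m2 : {measure set (T1 * T2) -> \bar R}) :
  (m1 setT < +oo)%E ->
  (forall A B, measurable A -> measurable B -> m1 (A `*` B) = m2 (A `*` B)) ->
  forall D, measurable D -> m1 D = m2 D.
Proof.
move=> m1T h D mD.
apply: (measure_unique _ (fun=> setT) (measurable_prod_measurableType T1 T2)) => //.
- move=> _ _ [A mA [B mB <-]] [A' mA' [B' mB' <-]].
  exists (A `&` A'); first exact: measurableI.
  by exists (B `&` B'); [exact: measurableI|rewrite setXI].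
- by move=> i; exists setT => //; exists setT => //; rewrite setXTT.
- by rewrite bigcup_const.
- by move=> _ [A mA [B mB <-]]; exact: h.
Qed.

Lemma eq_measure_prod3 (m1 m2 : {measure set (T1 * T2 * T3) -> \bar R}) :
  (m1 setT < +oo)%E ->
  (forall A B C, measurable A -> measurable B -> measurable C ->
    m1 (A `*` B `*` C) = m2 (A `*` B `*` C)) ->
  forall D, measurable D -> m1 D = m2 D.
Proof.
move=> m1T h D mD.
pose G : set (set (T1 * T2 * T3)) := [set D | exists A B C,
  [/\ measurable A, measurable B, measurable C & D = A `*` B `*` C]].
have Gm : G `<=` measurable.
  by move=> _ [A [B [C [mA mB mC ->]]]]; do 2 apply: measurableX => //.
apply: (g_sigma_algebra_measure_unique G Gm (fun=> setT)) => //.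
- by move=> i; exists setT, setT, setT; split => //; rewrite !setXTT.
- by rewrite bigcup_const.
- move=> _ _ [A [B [C [mA mB mC ->]]]] [A' [B' [C' [mA' mB' mC' ->]]]].
  exists (A `&` A'), (B `&` B'), (C `&` C'); split; try exact: measurableI.
  by rewrite !setXI.
- by move=> _ [A [B [C [mA mB mC ->]]]]; exact: h.
- pose TG : measurableType _ := g_sigma_algebraType G.
  have sub A : G A -> measurable (A : set TG) by exact: sub_sigma_algebra.
  have mid : measurable_fun setT
      (fun w : TG => (((w : T1 * T2 * T3).1.1, (w : T1 * T2 * T3).1.2),
                      (w : T1 * T2 * T3).2)).
    apply: measurable_fun_pair; first apply: measurable_fun_pair.
    + move=> _ A mA; apply: sub; exists A, setT, setT; split => //.
      by apply/seteqP; split => -[[? ?] ?] /=; tauto.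
    + move=> _ A mA; apply: sub; exists setT, A, setT; split => //.
      by apply/seteqP; split => -[[? ?] ?] /=; tauto.
    + move=> _ A mA; apply: sub; exists setT, setT, A; split => //.
      by apply/seteqP; split => -[[? ?] ?] /=; tauto.
  have := mid measurableT D mD; rewrite setTI.
  by congr (measurable _); apply/seteqP; split=> -[[? ?] ?].
Qed.

End product_uniqueness.

Section mixture.
Context d1 d2 (T1 : measurableType d1) (T2 : measurableType d2) (R : realType).
Variables (mu : {measure set T1 -> \bar R}) (k : R.-pker T1 ~> T2).
Local Open Scope ereal_scope.

(** The joint law of a pair whose first component has law [mu] and whose second has conditional law
    [k]. *)
Definition mixture (D : set (T1 * T2)) : \bar R := \int[mu]_x k x (xsection D x).

Lemma measurable_kernel_xsection D : measurable D ->
  measurable_fun setT (fun x => k x (xsection D x)).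
Proof. by move=> mD; apply: measurable_fun_xsection_finite_kernel; rewrite inE. Qed.

Let mixture0 : mixture set0 = 0.
Proof. by apply: integral0_eq => x _; rewrite xsection0. Qed.

Let mixture_ge0 D : 0 <= mixture D.
Proof. by apply: integral_ge0. Qed.

Let mixture_sigma_additive : semi_sigma_additive mixture.
Proof.
move=> F mF tF mUF.
rewrite [X in _ --> X](_ : _ = \sum_(i <oo) mixture (F i)); last first.
  rewrite /mixture -integral_nneseries//; last first.
    by move=> n; exact: measurable_kernel_xsection.
  apply: eq_integral => x _; rewrite xsection_bigcup.
  apply/esym/cvg_lim => //; apply: measure_semi_sigma_additive.
  - by move=> n; exact: measurable_xsection.
  - exact: trivIset_xsection.
  - by apply: bigcupT_measurable => n; exact: measurable_xsection.
by apply: is_cvg_nneseries => n _ _; exact: mixture_ge0.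
Qed.

HB.instance Definition _ := isMeasure.Build _ _ R mixture
  mixture0 mixture_ge0 mixture_sigma_additive.

Lemma mixtureX A B : measurable A -> measurable B ->
  mixture (A `*` B) = \int[mu]_(x in A) k x B.
Proof.
move=> mA mB; rewrite /mixture [RHS]integral_mkcond; apply: eq_integral => x _.
rewrite patchE; case: ifPn => xA; first by rewrite in_xsectionX.
by rewrite notin_xsectionX// measure0.
Qed.

(** A nonnegative function with zero integral vanishes almost everywhere, so almost every section of
    a null set is null. *)
Lemma ae_mixture (Q : set (T1 * T2)) :
  {ae mixture, forall w, Q w} ->
  \forall x \ae mu, {ae k x, forall y, Q (x, y)}.
Proof.
move=> [N [mN N0 QN]].
have : ae_eq mu setT (fun x => k x (xsection N x)) (cst 0).
  apply/ae_eq_integral_abs => //; first exact: measurable_kernel_xsection.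
  by rewrite -[RHS]N0; apply: eq_integral => x _; rewrite gee0_abs.
apply: filterS => x /(_ I) kx; exists (xsection N x); split => //.
- exact: measurable_xsection.
- by move=> y nQ; rewrite /xsection /= inE; apply: QN.
Qed.

End mixture.

Section conditional_law.
Context d (T : measurableType d) (R : realType) (P : probability T R).
Context d1 d2 (T1 : measurableType d1) (T2 : measurableType d2).
Variables (W : {RV P >-> T1}) (U : {RV P >-> T2}) (k : R.-pker T1 ~> T2).
Hypothesis kP : is_cond_law W U k.
Local Open Scope ereal_scope.

Lemma cond_law_mixture D : measurable D ->
  distribution P (rv_pair W U) D = mixture (distribution P W) k D.
Proof.
apply: eq_measure_prod.
  by rewrite (le_lt_trans (probability_le1 _ _))// ltry.
move=> A B mA mB; rewrite [RHS]mixtureX// -(kP mA mB) /distribution /pushforward.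
by congr (P _); apply/seteqP; split.
Qed.

(** Turns a statement on almost every pair into one on almost every [x] and then almost every [y];
    this is how [V] is separated from [(X, Z)], and [Z] from [X]. *)
Lemma ae_cond_law (Q : T1 * T2 -> Prop) :
  {ae distribution P (rv_pair W U), forall w, Q w} ->
  \forall x \ae distribution P W, {ae k x, forall y, Q (x, y)}.
Proof.
move=> [N [mN N0 QN]]; apply: ae_mixture.
by exists N; split => //; rewrite -cond_law_mixture.
Qed.

End conditional_law.

Section kernel_precomposition.
Context d0 d1 d2 (T0 : measurableType d0) (T1 : measurableType d1)
  (T2 : measurableType d2) (R : realType).
Variables (k : R.-pker T1 ~> T2) (g : T0 -> T1) (mg : measurable_fun setT g).

(** The proof of measurability is an argument so that the kernel instance is inferred from the term.
    With [g] a projection, the kernel forgets part of the conditioning variables, which expresses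
    conditional independence. *)
Definition kpre of measurable_fun setT g := fun x => k (g x).

Let measurable_kpre A : measurable A -> measurable_fun setT (kpre mg ^~ A).
Proof. by move=> mA; exact: measurableT_comp (measurable_kernel k A mA) mg. Qed.

HB.instance Definition _ := isKernel.Build _ _ _ _ R (kpre mg) measurable_kpre.

Let kpre_prob x : kpre mg x setT = 1%E.
Proof. exact: prob_kernel. Qed.

HB.instance Definition _ := Kernel_isProbability.Build _ _ _ _ R (kpre mg) kpre_prob.

End kernel_precomposition.

(** * Supports, densities and conditional independence *)

Section support.
Context {R : realType}.
Local Open Scope ereal_scope.

Lemma msupport_sub (T : topologicalType) (mu : set T -> \bar R) (D : set T) :
  closed D -> mu (~` D) = 0 -> msupport mu `<=` D.
Proof.
move=> cD D0 x sx; apply: contrapT => nDx.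
by have := sx _ (closed_openC cD) nDx; rewrite D0 ltxx.
Qed.

(** Each point off the support lies in a null interval with rational endpoints, and there are
    countably many of these. *)
Lemma negligible_msupportC (mu : {measure set R -> \bar R}) :
  mu.-negligible (~` msupport mu).
Proof.
pose F (c : rat * rat) : set R :=
  if mu `]ratr c.1, ratr c.2[%classic == 0 then `]ratr c.1, ratr c.2[%classic else set0.
have mF c : measurable (F c) by rewrite /F; case: ifPn.
exists (\bigcup_c F c); split.
- exact: countable_bigcupT_measurable.
- apply/eqP; rewrite -measure_le0.
  have [f fE] : exists f : nat -> rat * rat, forall c, exists n, f n = c.
    (* [unpickle] is partial; the default pair is harmless, because [F] is null at every pair. *)
    pose f (n : nat) : rat * rat := odflt (0%Q, 0%Q) (@choice.unpickle (rat * rat)%type n).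
    by exists f => c; exists (@choice.pickle (rat * rat)%type c); rewrite /f choice.pickleK.
  apply: (@le_trans _ _ (\sum_(n <oo) mu (F (f n)))).
    apply: (@measure_sigma_subadditive _ _ _ mu _ (fun n => F (f n))) => //.
      exact: countable_bigcupT_measurable.
    by move=> x [c _ Fx]; have [n fn] := fE c; exists n => //; rewrite fn.
  rewrite eseries0// => n _ _; rewrite /F; case: ifPn => [/eqP//|_].
  by rewrite measure0.
- move=> x /= /existsNP[U /not_implyP[oU /not_implyP[Ux /negP]]].
  rewrite lt0e negb_and negbK measure_ge0 orbF => /eqP muU.
  have /nbhs_ballP[e /= e0 eU] : nbhs x U by exact: open_nbhs_nbhs.
  have [q] := @rat_in_itvoo R (x - e) x ltac:(by rewrite gtrBl).
  rewrite in_itv/= => /andP[q1 q2].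
  have [r] := @rat_in_itvoo R x (x + e) ltac:(by rewrite ltrDl).
  rewrite in_itv/= => /andP[r1 r2].
  exists (q, r) => //; rewrite /F/= ifT/= ?in_itv/= ?q2 ?r1//.
  rewrite -measure_le0 -muU le_measure ?inE//; first exact: open_measurable.
  move=> y /=; rewrite in_itv/= => /andP[y1 y2]; apply: eU.
  rewrite /ball/= distrC ltr_distl (lt_trans q1 y1)/=.
  by rewrite (lt_trans y2 r2).
Qed.

End support.

Section finite_pushforward.
Context d1 d2 (T1 : measurableType d1) (T2 : measurableType d2) (R : realType).
Variables (mu : {measure set T1 -> \bar R}) (f : T1 -> T2).
Hypotheses (mf : measurable_fun setT f) (muT : (mu setT < +oo)%E).

(** Both proofs are arguments so that the finite measure instance is inferred from the term. *)
Definition fpush of measurable_fun setT f & (mu setT < +oo)%E :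
  set T2 -> \bar R := pushforward mu f.

Let m : {measure set T2 -> \bar R} :=
  measure_function_pushforward__canonical__measure_function_Measure mu mf.

HB.instance Definition _ := isMeasure.Build _ _ _ (fpush mf muT)
  (measure0 m) (measure_ge0 m) (@measure_semi_sigma_additive _ _ _ m).

Let fin_fpush : fin_num_fun (fpush mf muT).
Proof.
move=> A mA; rewrite ge0_fin_numE// (le_lt_trans _ muT)//.
by rewrite /fpush /pushforward le_measure ?inE// -[X in measurable X]setTI; exact: mf.
Qed.

HB.instance Definition _ := @Measure_isFinite.Build _ _ _ (fpush mf muT) fin_fpush.

End finite_pushforward.

Section density.
Context d (T : measurableType d) (R : realType).
Variables (mu : {sigma_finite_measure set T -> \bar R})
  (nu : {finite_measure set T -> \bar R}) (f : T -> R).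
Hypothesis nuf : is_density mu nu f.
Local Open Scope ereal_scope.

Lemma density_dominates : nu `<< mu.
Proof.
have [mf f0 nuE] := nuf; apply/null_content_dominatesP => A mA muA0.
rewrite nuE// (eq_integral (fun x => `|(f x)%:E|)); last first.
  by move=> x _; rewrite gee0_abs// lee_fin.
by apply: integral_abs_eq0 => //; apply/measurable_EFinP; exact: measurable_funTS.
Qed.

(** [f] agrees almost everywhere with the Radon-Nikodym derivative, since both have the same
    integrals over measurable sets. *)
Lemma integral_density g : measurable_fun setT g -> (forall x, 0 <= g x) ->
  \int[nu]_x g x = \int[mu]_x (g x * (f x)%:E).
Proof.
move=> mg g0; have [mf f0 nuE] := nuf; have nm := density_dominates.
rewrite -(Radon_Nikodym_SigmaFinite.change_of_variables nm)//.
have ig := Radon_Nikodym_SigmaFinite.f_integrable nm.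
apply: ae_eq_integral => //.
- by apply: emeasurable_funM => //; exact: measurable_int ig.
- by apply: emeasurable_funM => //; exact/measurable_EFinP.
apply: ae_eqe_mul2l; apply: integral_ae_eq => //; first exact/measurable_EFinP.
move=> A _ mA; rewrite -nuE//.
by rewrite -Radon_Nikodym_SigmaFinite.f_integral.
Qed.

End density.

Section conditional_independence.
Context d (T : measurableType d) (R : realType) (P : probability T R).
Context dX (TX : measurableType dX) (X : {RV P >-> TX}).
Local Open Scope ereal_scope.

Lemma measurable_rv_preimage d' (T' : measurableType d') (X' : {RV P >-> T'}) A :
  measurable A -> measurable (X' @^-1` A).
Proof. by move=> mA; rewrite -[X in measurable X]setTI; exact: measurable_funPT. Qed.

Lemma mrestr_lty E (mE : measurable E) : mrestr P mE setT < +oo.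
Proof. by rewrite (le_lt_trans (probability_le1 _ _)) ?ltry//; exact: measurableI. Qed.

(** Gives to [A] the probability that [X] lies in [A] and [E] occurs; its density with respect to
    the law of [X] is the conditional probability of [E]. *)
Definition rv_trace E (mE : measurable E) : {finite_measure set TX -> \bar R} :=
  fpush (measurable_funPT X) (mrestr_lty mE).

(** [cond_independent] speaks of given versions of the conditional probabilities, so one has to be
    produced before it can be applied. *)
Lemma cond_prob_exists (E : set T) : measurable E ->
  exists2 q : TX -> R, is_cond_prob X E q & forall x, (0 <= q x)%R.
Proof.
move=> mE; have nm : rv_trace mE `<< distribution P X.
  apply/null_content_dominatesP => A mA A0.
  apply/eqP; rewrite -measure_le0 -A0; apply: (@le_measure _ _ _ P).
  - by rewrite inE; apply: measurableI => //; exact: measurable_rv_preimage.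
  - by rewrite inE; exact: measurable_rv_preimage.
  - exact: subIsetl.
pose f := Radon_Nikodym_SigmaFinite.f (rv_trace mE) (distribution P X).
have qE x : (fine (f x))%:E = f x by rewrite fineK// Radon_Nikodym_SigmaFinite.f_fin_num.
have ig := Radon_Nikodym_SigmaFinite.f_integrable nm.
exists (fine \o f); last by move=> x; rewrite fine_ge0// Radon_Nikodym_SigmaFinite.f_ge0.
split.
  apply/measurable_EFinP; rewrite (_ : EFin \o _ = f); last exact/funext.
  exact: measurable_int ig.
by move=> A mA; under eq_integral do rewrite qE; rewrite -Radon_Nikodym_SigmaFinite.f_integral.
Qed.

(** Both sides are the integral of [g] against [rv_trace], which has density [q], and which is the
    image of the measure with density [\1_E]. *)
Lemma integral_cond_prob (E : set T) (q : TX -> R) g : measurable E ->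
  is_cond_prob X E q -> (forall x, (0 <= q x)%R) ->
  measurable_fun setT g -> (forall x, 0 <= g x) ->
  \int[P]_(w in E) g (X w) = \int[distribution P X]_x (g x * (q x)%:E).
Proof.
move=> mE [mq qE] q0 mg g0.
have dq : is_density (distribution P X) (rv_trace mE) q by split.
have PE : P E < +oo by rewrite (le_lt_trans (probability_le1 P mE))// ltry.
have dE : is_density P (mfrestr mE PE) (\1_E).
  split=> [|x|B mB]; [exact: measurable_indic|by rewrite indicE|].
  by rewrite integral_indic// setIC.
rewrite -(integral_density dq)// ge0_integral_pushforward//= preimage_setT.
rewrite [RHS](integral_density dE) => [|//|//]; last exact: measurableT_comp.
by rewrite integral_mkcond epatch_indic.
Qed.

Lemma cond_law_cond_prob d' (T' : measurableType d') (U : {RV P >-> T'})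
    (k : R.-pker TX ~> T') B : is_cond_law X U k -> measurable B ->
  is_cond_prob X (U @^-1` B) (fun x => fine (k x B)).
Proof.
move=> kP mB; split.
  by apply: measurableT_comp => //; exact: measurable_kernel.
move=> A mA; rewrite kP//; apply: eq_integral => x _.
by rewrite fineK//; exact: finite_kernel_measure.
Qed.

(** On a box, conditional independence gives the integral over [A] of [q x * k x C], and
    [integral_cond_prob] turns the factor [q] back into a restriction to the event that [W] lies in
    [B]. *)
Lemma cond_independent_law d1 d2 (T1 : measurableType d1) (T2 : measurableType d2)
    (W : {RV P >-> T1}) (U : {RV P >-> T2}) (k : R.-pker TX ~> T2) :
  cond_independent X W U -> is_cond_law X U k ->
  forall D, measurable D -> distribution P (rv_pair (rv_pair X W) U) D =
    mixture (distribution P (rv_pair X W)) (kpre k measurable_fst) D.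
Proof.
move=> XWU kP; apply: eq_measure_prod3.
  by rewrite (le_lt_trans (probability_le1 _ _))// ltry.
move=> A B C mA mB mC; rewrite [RHS]mixtureX//; last exact: measurableX.
have mWB := measurable_rv_preimage W mB.
have [q qP q0] := cond_prob_exists mWB.
have rP := cond_law_cond_prob kP mC.
have [_ /(_ _ mA)] := XWU _ _ mB mC _ _ qP rP.
rewrite [X in P X](_ : _ = rv_pair (rv_pair X W) U @^-1` (A `*` B `*` C)); last first.
  by apply/seteqP; split => w /=; tauto.
move=> h; apply: (etrans h); pose g := (fun x => k x C) \_ A.
have mg : measurable_fun setT g.
  by apply/(measurable_restrict _ mA measurableT); apply: measurable_funTS;
    exact: measurable_kernel.
have g0 x : 0 <= g x by rewrite /g patchE; case: ifPn.
transitivity (\int[distribution P X]_x (g x * (q x)%:E)).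
  rewrite [LHS]integral_mkcond; apply: eq_integral => x _; rewrite /g !patchE.
  case: ifPn => _; last by rewrite mul0e.
  by rewrite EFinM fineK 1?muleC//; exact: finite_kernel_measure.
rewrite -(integral_cond_prob mWB qP q0 mg g0).
rewrite ge0_integral_pushforward//; last 2 first.
- exact: measurableX.
- apply: measurable_funTS; exact: measurable_kernel.
rewrite (_ : _ @^-1` (A `*` B) = W @^-1` B `&` X @^-1` A); last first.
  by apply/seteqP; split => w /=; tauto.
rewrite integral_mkcondr; apply: eq_integral => w _.
by rewrite /g !patchE.
Qed.

End conditional_independence.

(** * Agreement of the laws below a threshold *)

(** Dominated convergence works along sequences, hence this criterion. *)
Lemma closed_seq (R : realType) (T : pseudoMetricType R) (D : set T) :
  (forall (u : nat -> T) v, (forall n, D (u n)) -> u n @[n --> \oo] --> v -> D v) ->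
  closed D.
Proof.
move=> h v vD.
have /choice[u uP] : forall n : nat, exists w, D w /\ ball v n.+1%:R^-1 w.
  move=> n; have n0 : 0 < n.+1%:R^-1 :> R by rewrite invr_gt0.
  have [w [Dw bw]] := vD _ (nbhsx_ballx v _ n0).
  by exists w.
apply: (h u) => [n|]; first by case: (uP n).
apply/cvg_ballP => e e0; near=> n; have [_] := uP n; apply: le_ball.
by apply: ltW; near: n; exact: near_infty_natSinv_lt (PosNum e0).
Unshelve. all: by end_near. Qed.

Section threshold_sections.
Context {R : realType} {n : nat}.
Local Notation U := (R * R * 'rV[R]_n)%type.
Implicit Types (mu : {measure set U -> \bar R}) (E : set R) (v : R).
Local Open Scope ereal_scope.

(** The event of the probability [G_E(v)]: at [V = v] and [Z = z], an observed outcome in [E]. *)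
Definition below (z : 'rV[R]_n) E v : set U :=
  [set u | E (outcome u) /\ (threshold z u < v)%R].

Lemma measurable_preimage d1 d2 (T1 : measurableType d1) (T2 : measurableType d2)
  (f : T1 -> T2) A : measurable_fun setT f -> measurable A -> measurable (f @^-1` A).
Proof. by move=> mf mA; rewrite -[X in measurable X]setTI; exact: mf. Qed.

Lemma belowE z E v : below z E v =
  @outcome R n @^-1` E `&` @threshold R n z @^-1` `]-oo, v[.
Proof. by apply/seteqP; split=> u; rewrite /below /= in_itv. Qed.

Lemma measurable_below z E v : measurable E -> measurable (below z E v).
Proof.
move=> mE; rewrite belowE; apply: measurableI; apply: measurable_preimage => //.
- exact: measurable_outcome.
- exact: measurable_threshold.
Qed.

(** From the right the limit could include the event that the threshold equals [v]; the absence of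
    an atom removes it. *)
Lemma below_cvg mu z E v (w : nat -> R) : measurable E -> mu setT < +oo ->
  mu (@threshold R n z @^-1` [set v]) = 0 -> w k @[k --> \oo] --> v ->
  fine (mu (below z E (w k))) @[k --> \oo] --> fine (mu (below z E v)).
Proof.
move=> mE muT mu0 wv; set N := _ @^-1` [set v] in mu0.
have mN : measurable N by apply: measurable_preimage => //; exact: measurable_threshold.
have bE v' : fine (mu (below z E v')) = (\int[mu]_u \1_(below z E v' `\` N) u)%R.
  rewrite /Rintegral integral_indic//; last first.
    by apply: measurableD => //; exact: measurable_below.
  rewrite setIT; congr fine; rewrite [in LHS](measureDI mu (measurable_below z v' mE) mN).
  rewrite [X in _ + X](_ : _ = 0) ?adde0//.
  apply/eqP; rewrite -measure_le0 -mu0 le_measure ?inE//.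
  by apply: measurableI => //; exact: measurable_below.
(* The indicators converge off the null set [N] only, hence its removal. *)
rewrite bE; under eq_cvg do rewrite bE.
apply: (@bounded_cvg_Rintegral _ _ _ mu (fun k u => \1_(below z E (w k) `\` N) u) _ 1%R) => //.
- move=> k; apply: measurable_indic; apply: measurableD => //; exact: measurable_below.
- by move=> k u /=; rewrite indicE; case: (_ \in _); rewrite ?normr1 ?normr0.
- move=> u; apply: cvg_near_cst.
  have E1 v' : \1_(below z E v' `\` N) u = ((u \in @outcome R n @^-1` E) &&
      ((threshold z u < v') && (threshold z u != v)) : nat)%:R%R :> R.
    rewrite indicE; congr (nat_of_bool _)%:R%R; apply/idP/idP.
      move=> /set_mem[[Eu uv] uN]; rewrite mem_set//= uv/=.
      by apply/eqP => uE; apply: uN; rewrite /N /= uE.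
    move=> /andP[/set_mem Eu /andP[uv /eqP uN]].
    by apply/mem_set; split.
  suff : \forall k \near \oo, (threshold z u < w k)%R && (threshold z u != v) =
      (threshold z u < v)%R && (threshold z u != v).
    by apply: filterS => k wk; rewrite !E1 wk.
  have [uv|uv|->] := ltgtP (threshold z u) v.
  + by near=> k; rewrite !andbT; near: k; exact: (cvgr_gt v wv).
  + near=> k; rewrite !andbT; apply/negbTE; rewrite -leNgt ltW//.
    by near: k; exact: (cvgr_lt v wv).
  + by near=> k; rewrite !andbF.
Unshelve. all: by end_near. Qed.

Lemma below_le mu z E v v' : measurable E -> (v <= v')%R ->
  mu (below z E v) <= mu (below z E v').
Proof.
move=> mE vv'; rewrite le_measure ?inE//; try exact: measurable_below.
by move=> u [Eu uv]; split=> //; exact: lt_le_trans vv'.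
Qed.

Lemma belowD mu z E v : measurable E ->
  mu (below z setT v) = mu (below z E v) + mu (below z (~` E) v).
Proof.
move=> mE; rewrite -measureU.
- congr (mu _); apply/seteqP; split=> u; rewrite /below /=.
    by move=> [_ uv]; have [Eu|Eu] := pselect (E (outcome u)); [left|right].
  by move=> [[]|[]].
- exact: measurable_below.
- by apply: measurable_below; exact: measurableC.
- by apply/seteqP; split=> // u [[Eu _] [/(_ Eu)]].
Qed.

Section agreement.
Variables (mu1 mu2 : {measure set U -> \bar R}) (z : 'rV[R]_n).
Hypotheses (mu1T : mu1 setT = 1) (mu2T : mu2 setT = 1).
Hypothesis mu1_atomless : forall v, mu1 (@threshold R n z @^-1` [set v]) = 0.

Let mu1oo : mu1 setT < +oo. Proof. by rewrite mu1T ltry. Qed.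
Let mu2oo : mu2 setT < +oo. Proof. by rewrite mu2T ltry. Qed.

Definition agreement : set R :=
  [set v | forall E, measurable E -> mu1 (below z E v) = mu2 (below z E v)].

Lemma fin_below mu E v : mu setT < +oo -> measurable E ->
  mu (below z E v) \is a fin_num.
Proof.
move=> muT mE; rewrite ge0_fin_numE// (le_lt_trans _ muT)//.
by rewrite le_measure ?inE//; exact: measurable_below.
Qed.

Lemma closed_agreement :
  (forall v, mu2 (@threshold R n z @^-1` [set v]) = 0) -> closed agreement.
Proof.
move=> mu2_atomless; apply: closed_seq => w v Dw wv E mE.
rewrite -(fineK (fin_below v mu1oo mE)) -(fineK (fin_below v mu2oo mE)); congr _%:E.
have c1 := below_cvg mE mu1oo (mu1_atomless v) wv.
have c2 := below_cvg mE mu2oo (mu2_atomless v) wv.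
have E12 : (fun k => fine (mu1 (below z E (w k)))) = (fun k => fine (mu2 (below z E (w k)))).
  by apply/funext => k; rewrite Dw.
by rewrite E12 in c1; exact: cvg_unique c1 c2.
Qed.

Hypothesis closedD : closed agreement.
Hypothesis nullD : mu1 (@threshold R n z @^-1` (~` agreement)) = 0.

Let mND : measurable (@threshold R n z @^-1` (~` agreement)).
Proof.
apply: measurable_preimage; first exact: measurable_threshold.
by apply: open_measurable; exact: closed_openC.
Qed.

Let mN1 v : measurable (@threshold R n z @^-1` [set v]).
Proof. by apply: measurable_preimage => //; exact: measurable_threshold. Qed.

(** The gap adds only the endpoint [v], which is no atom, and points of disagreement, which are
    null. *)
Let below_gap E v v' : measurable E ->
  (forall t, v < t < v' -> ~ agreement t)%R -> mu1 (below z E v') <= mu1 (below z E v).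
Proof.
move=> mE gap.
have sub : below z E v' `<=` below z E v `|`
    (@threshold R n z @^-1` [set v] `|` @threshold R n z @^-1` (~` agreement)).
  move=> u [Eu uv']; have [uv|uv|uv] := ltgtP (threshold z u) v; first by left.
    by right; right; apply: gap; rewrite uv.
  by right; left.
apply: le_trans (_ : mu1 (below z E v `|`
    (@threshold R n z @^-1` [set v] `|` @threshold R n z @^-1` (~` agreement))) <= _).
  rewrite le_measure ?inE//; first exact: measurable_below.
  by apply: measurableU; [exact: measurable_below|exact: measurableU].
rewrite (le_trans (measureU2 _ _ _))//; [exact: measurable_below|exact: measurableU|].
rewrite -[leRHS]adde0 leeD2l//.
have <- : mu1 (@threshold R n z @^-1` [set v]) +
          mu1 (@threshold R n z @^-1` (~` agreement)) = 0.
  by rewrite nullD mu1_atomless adde0.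
exact: measureU2.
Qed.

(** Compare at the last point of agreement not above [v]: [mu1] gains nothing between it and [v],
    while [mu2] can only grow. If there is no such point, [mu1] has no mass below [v]. *)
Let below_mu1_le E v : measurable E -> mu1 (below z E v) <= mu2 (below z E v).
Proof.
move=> mE; have [[t Dt tv]|noD] := pselect (exists2 t, agreement t & (t <= v)%R).
  pose A := agreement `&` [set t | (t <= v)%R].
  have A0 : A !=set0 by exists t.
  have ubA : has_ubound A by exists v => s [].
  have Da : agreement (sup A).
    by apply: closedD; apply: closureS (closure_sup A0 ubA); exact: subIsetl.
  have av : (sup A <= v)%R by apply: ge_sup => // s [].
  apply: (@le_trans _ _ (mu1 (below z E (sup A)))).
    apply: below_gap => // s /andP[as_ sv] Ds.
    have : (s <= sup A)%R by apply: ub_le_sup => //; split => //; exact: ltW.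
    by rewrite leNgt as_.
  by rewrite Da// below_le.
rewrite (_ : mu1 _ = 0)//; apply/eqP; rewrite -measure_le0 -nullD le_measure ?inE//.
  exact: measurable_below.
by move=> u [_ uv] Du; apply: noD; exists (threshold z u) => //; exact: ltW.
Qed.

(** The mirror image, from the first point of agreement not below [v]. If there is none, [mu1] has
    all its mass below [v] and the total mass [1] bounds [mu2]; for a general [E] the two total
    masses could not yet be compared. *)
Let below_mu2_le v : mu2 (below z setT v) <= mu1 (below z setT v).
Proof.
have [[t Dt tv]|noD] := pselect (exists2 t, agreement t & (v <= t)%R).
  (* The infimum of the points of agreement above [v] is handled as a supremum of opposites. *)
  pose A := [set s : R | agreement (- s)%R /\ (s <= - v)%R].
  have A0 : A !=set0 by exists (- t)%R; split; rewrite ?opprK// lerN2.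
  have ubA : has_ubound A by exists (- v)%R => s [].
  have Da : agreement (- sup A)%R.
    have cA : closed [set s : R | agreement (- s)%R].
      by apply: (closed_comp _ closedD) => s _; exact: opp_continuous.
    by apply: cA; apply: closureS (closure_sup A0 ubA) => s [].
  have av : (v <= - sup A)%R by rewrite lerNr; apply: ge_sup => // s [].
  apply: (@le_trans _ _ (mu2 (below z setT (- sup A)%R))); first exact: below_le.
  rewrite -Da//; apply: below_gap => // s /andP[vs sa] Ds.
  have : (- s <= sup A)%R.
    by apply: ub_le_sup => //; split; [rewrite opprK|rewrite lerN2 ltW].
  by rewrite lerNl leNgt sa.
apply: (@le_trans _ _ 1).
  by rewrite -mu2T le_measure ?inE//; exact: measurable_below.
rewrite -mu1T [leRHS](_ : _ = mu1 (below z setT v) + 0); last by rewrite adde0.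
rewrite -nullD (le_trans _ (measureU2 _ _ _))//; last exact: measurable_below.
rewrite le_measure ?inE//; first by apply: measurableU => //; exact: measurable_below.
move=> u _; have [uv|uv] := ltP (threshold z u) v; [by left|right => Du].
by apply: noD; exists (threshold z u).
Qed.

(* On the whole line the two thresholds have the same law, so that [below_mu1_le]
   applied to [E] and to its complement must be an equality. *)
Lemma agreement_setT : agreement = setT.
Proof.
apply/seteqP; split=> // v _ E mE; apply/eqP; rewrite eq_le below_mu1_le//=.
have mE' : measurable (~` E) by exact: measurableC.
have := below_mu2_le v; rewrite !(belowD _ _ _ mE) => h.
have : mu2 (below z E v) + mu2 (below z (~` E) v) <=
    mu1 (below z E v) + mu2 (below z (~` E) v).
  by rewrite (le_trans h)// leeD2l// below_mu1_le.
by rewrite leeD2rE// fin_below.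
Qed.

End agreement.

End threshold_sections.

(** * Quasi-analytic continuation *)

Section quasi_analytic_continuation.
Context {R : realType} {E : normedModType R} {I : Type} (e : I -> E).

(** Equality near [x] also holds near every point close to [x], so that it survives each
    derivation. *)
Lemma near_pderivs (s : seq I) (f g : E -> R) (x : E) :
  (\forall y \near x, f y = g y) -> \forall y \near x, pderivs e s f y = pderivs e s g y.
Proof.
move=> fg; elim: s => [//|i s IH] /=.
apply: filterS (near_join IH) => y; exact: near_eq_derive.
Qed.

Lemma quasi_analytic_eq (C : set (E -> R[i])) f g (O : set E) :
  quasi_analytic_class e C -> C f -> C g -> open O -> O !=set0 ->
  (forall x, O x -> f x = g x) -> f = g.
Proof.
move=> [_ qa] Cf Cg oO [x0 Ox0] fg; apply: (qa _ _ Cf Cg x0) => s.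
have fgx : \forall y \near x0, f y = g y.
  by apply: filterS (open_nbhs_nbhs (conj oO Ox0)); exact: fg.
have H (h : R[i] -> R) : pderivs e s (h \o f) x0 = pderivs e s (h \o g) x0.
  have fh : \forall y \near x0, (h \o f) y = (h \o g) y.
    by apply: filterS fgx => y /= ->.
  exact: nbhs_singleton (near_pderivs s fh).
by rewrite /cpderivs !H.
Qed.

(** Differentiability at order zero, [s = [::]]. Continuity is what lets integrals over intervals
    determine a version of [a] pointwise. *)
Lemma quasi_analytic_continuous (C : set (E -> R[i])) f :
  quasi_analytic_class e C -> C f ->
  continuous (@complex.Re R \o f) /\ continuous (@complex.Im R \o f).
Proof.
move=> [[Ms ->] _] [sf _]; split=> x; have [h1 h2] := sf [::] x;
  exact: differentiable_continuous.
Qed.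

End quasi_analytic_continuation.

(** * Joint integrals of the outcome and the threshold *)

Section weighted_agreement.
Context {R : realType} {n : nat}.
Local Notation U := (R * R * 'rV[R]_n)%type.
Implicit Types (mu : {measure set U -> \bar R}) (phi : R -> R).

Lemma density_atomless mu z f v :
  is_density lebesgue_measure (pushforward mu (@threshold R n z)) f ->
  mu (@threshold R n z @^-1` [set v]) = 0%E.
Proof.
by move=> [mf f0 nuE]; have := nuE [set v] (measurable_set1 _); rewrite integral_set1.
Qed.

Lemma full_support_agreement mu1 mu2 z :
  mu1 setT = 1%E -> mu2 setT = 1%E ->
  (forall v, mu1 (@threshold R n z @^-1` [set v]) = 0%E) ->
  (forall v, mu2 (@threshold R n z @^-1` [set v]) = 0%E) ->
  msupport (pushforward mu1 (threshold z)) `<=` agreement mu1 mu2 z ->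
  agreement mu1 mu2 z = setT.
Proof.
move=> m1 m2 a1 a2 sD.
have cD := closed_agreement m1 m2 a1 a2.
apply: agreement_setT => //.
have m1oo : (mu1 setT < +oo)%E by rewrite m1 ltry.
have := negligible_msupportC (fpush (measurable_threshold z) m1oo).
move=> /(negligibleS (subsetC sD)); apply: measure_negligible.
by apply: open_measurable; exact: closed_openC.
Qed.

Lemma agreement_itv mu1 mu2 z E (u v : R) : measurable E -> u <= v ->
  mu1 setT = 1%E -> mu2 setT = 1%E ->
  agreement mu1 mu2 z u -> agreement mu1 mu2 z v ->
  mu1 (@outcome R n @^-1` E `&` @threshold R n z @^-1` `[u, v[) =
  mu2 (@outcome R n @^-1` E `&` @threshold R n z @^-1` `[u, v[).
Proof.
move=> mE uv m1 m2 Du Dv.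
have -> : @outcome R n @^-1` E `&` @threshold R n z @^-1` `[u, v[ =
    below z E v `\` below z E u.
  apply/seteqP; split=> w; rewrite /below /= in_itv/=.
    by move=> [Ew /andP[uw wv]]; split=> // -[_]; rewrite ltNge uw.
  move=> [[Ew wv] nu]; split=> //; rewrite wv andbT leNgt; apply/negP => wu.
  exact: nu.
have sub : below z E u `<=` below z E v.
  by move=> w [Ew wu]; split=> //; exact: lt_le_trans uv.
have m1oo : (mu1 setT < +oo)%E by rewrite m1 ltry.
have m2oo : (mu2 setT < +oo)%E by rewrite m2 ltry.
rewrite !measureD//; try exact: measurable_below; last 2 first.
- by rewrite -ge0_fin_numE// fin_below.
- by rewrite -ge0_fin_numE// fin_below.
by rewrite setIidr//; congr (_ - _)%E; [exact: Dv|exact: Du].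
Qed.

Lemma Rintegral_indic_setI mu (A B : set U) : measurable A -> measurable B ->
  \int[mu]_u (\1_A u * \1_B u) = fine (mu (A `&` B)).
Proof.
move=> mA mB; rewrite /Rintegral -[in RHS](setIT (A `&` B)) -integral_indic//.
  by congr fine; apply: eq_integral => u _; rewrite indicI.
exact: measurableI.
Qed.

(** At fixed [E], agreement says that the laws of the threshold restricted to outcomes in [E]
    coincide on half-lines, which determine them and hence their bounded integrals. *)
Lemma agreement_integral mu1 mu2 z (E : set R) h : measurable E ->
  mu1 setT = 1%E -> mu2 setT = 1%E -> agreement mu1 mu2 z = setT ->
  bounded_measurable h ->
  \int[mu1]_u (\1_E (outcome u) * h (threshold z u)) =
  \int[mu2]_u (\1_E (outcome u) * h (threshold z u)).
Proof.
move=> mE m1 m2 DT bh.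
have m1oo : (mu1 setT < +oo)%E by rewrite m1 ltry.
have m2oo : (mu2 setT < +oo)%E by rewrite m2 ltry.
have mYE : measurable (@outcome R n @^-1` E).
  by apply: measurable_preimage => //; exact: measurable_outcome.
have mr mu : (mu setT < +oo)%E -> (mrestr mu mYE setT < +oo)%E.
  move=> muT; apply: le_lt_trans muT; rewrite /mrestr setTI.
  by apply: (@le_measure _ _ _ mu); rewrite ?inE.
have mt := measurable_threshold z.
apply: eq_Rintegral_indic_comp => //; first exact: (bounded_measurable_indic mYE).
move=> A mA; rewrite !(@Rintegral_indic_setI _ (_ @^-1` _) (_ @^-1` _))//;
  try exact: measurable_preimage.
congr fine.
pose nu mu (muT : (mu setT < +oo)%E) := fpush mt (mr mu muT).
have nuE mu muT B : nu mu muT B = mu (@outcome R n @^-1` E `&` @threshold R n z @^-1` B).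
  by rewrite setIC.
rewrite -(nuE mu1 m1oo) -(nuE mu2 m2oo).
apply: (measure_unique (RGenInftyO.G (R := R)) (fun k : nat => `]-oo, k%:R[%classic)
  (RGenInftyO.measurableE R)) mA.
- move=> _ _ [a ->] [b ->]; exists (Num.min a b).
  by apply/seteqP; split=> t /=; rewrite !in_itv/= lt_min => /andP.
- by move=> k; exists k%:R.
- apply/seteqP; split=> // t _; exists (Num.bound `|t|) => //=; rewrite in_itv/=.
  by rewrite (le_lt_trans (ler_norm _))// archi_boundP.
- move=> _ [a ->]; apply: (etrans (nuE mu1 m1oo _)).
  apply: esym; apply: (etrans (nuE mu2 m2oo _)); rewrite -belowE.
  have Da : agreement mu1 mu2 z a by rewrite DT.
  by rewrite (Da _ mE).
- by move=> k; rewrite ltey_eq fin_num_measure.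
Qed.

End weighted_agreement.

Lemma integral_density_EFin d (T : measurableType d) (R : realType)
    (mu : {sigma_finite_measure set T -> \bar R})
    (nu : {finite_measure set T -> \bar R}) (f g : T -> R) :
  is_density mu nu f -> measurable_fun setT g ->
  (\int[nu]_x (g x)%:E = \int[mu]_x (g x * f x)%:E)%E.
Proof.
move=> nuf mg; have [mf f0 _] := nuf.
have mg' : measurable_fun setT (EFin \o g) by exact/measurable_EFinP.
rewrite integralE [RHS]integralE.
rewrite (integral_density nuf)//; last exact: measurable_funepos.
rewrite (integral_density nuf)//; last exact: measurable_funeneg.
congr (_ - _)%E; apply: eq_integral => x _.
  by rewrite !funeposE EFinM maxe_pMl// ?mul0e// lee_fin.
by rewrite !funenegE EFinM -mulNe maxe_pMl// ?mul0e// lee_fin.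
Qed.

Section density_weight.
Context {R : realType} {n : nat}.
Local Notation U := (R * R * 'rV[R]_n)%type.
Implicit Types (mu : {measure set U -> \bar R}) (phi : R -> R).

Lemma Rintegral_indic_mul d (T : measurableType d) (m : {measure set T -> \bar R})
    (A : set T) (g : T -> R) :
  \int[m]_x (g x * \1_A x) = \int[m]_(x in A) g x.
Proof.
rewrite [RHS]Rintegral_mkcond; apply: eq_Rintegral => x _.
by rewrite patchE indicE; case: ifPn => xA; rewrite ?mulr1 ?mulr0.
Qed.

(** The conditional expectation is tested on the event that the threshold lies in [A], then the
    density is used. The integrals of the product are thus the same for all choices of versions. *)
Lemma version_a_integral mu z phi m f A : mu setT = 1%E ->
  is_cond_expectation mu (@threshold R n z) (phi \o @outcome R n) m ->
  is_density lebesgue_measure (pushforward mu (@threshold R n z)) f ->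
  measurable A ->
  \int[mu]_u (phi (outcome u) * \1_A (threshold z u)) =
  \int[lebesgue_measure]_(t in A) (m t * f t).
Proof.
move=> mu1 [mm im mE] df mA.
have muT : (mu setT < +oo)%E by rewrite mu1 ltry.
have mt := measurable_threshold z.
rewrite (@Rintegral_indic_mul _ _ mu (@threshold R n z @^-1` A) (phi \o @outcome R n)).
rewrite /Rintegral; congr fine; rewrite mE//.
(* [lebesgue_measure] lives on [measurableTypeR R], whose display is not that of [R]. *)
pose nu : {finite_measure set (measurableTypeR R) -> \bar R} :=
  @fpush _ _ _ (measurableTypeR R) _ _ _ mt muT.
transitivity (\int[nu]_(t in A) (m t)%:E)%E.
  rewrite (@integral_pushforward _ _ _ (measurableTypeR R) _ _ mt mu A (EFin \o m))//.
    exact/measurable_EFinP.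
  apply: integrableS im => //; exact: measurable_preimage.
transitivity (\int[nu]_t (m t * \1_A t)%:E)%E.
  rewrite [LHS]integral_mkcond; apply: eq_integral => t _.
  by rewrite patchE indicE; case: ifPn => _; rewrite ?mulr1 ?mulr0.
rewrite (@integral_density_EFin _ (measurableTypeR R) R lebesgue_measure nu f)//.
  rewrite [RHS]integral_mkcond; apply: eq_integral => t _.
  by rewrite patchE indicE; case: ifPn => _; rewrite ?mulr1// mulr0 mul0r.
by apply: measurable_funM => //; exact: measurable_indic.
Qed.

(** Otherwise [a1 - a2] would exceed half its value at [x] on a short interval, and its integral
    there would be positive. *)
Lemma le_continuous_Rintegral (a1 a2 : R -> R) (x e : R) : 0 < e ->
  continuous a1 -> continuous a2 ->
  (forall v, x < v < x + e -> \int[lebesgue_measure]_(t in `[x, v[) a1 t =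
     \int[lebesgue_measure]_(t in `[x, v[) a2 t) ->
  a1 x <= a2 x.
Proof.
move=> e0 c1 c2 H; rewrite leNgt; apply/negP => a21.
pose c := (a1 x - a2 x) / 2.
have c0 : 0 < c by rewrite divr_gt0// subr_gt0.
have cg : {for x, continuous (fun t => a1 t - a2 t)} by apply: cvgB; [exact: c1|exact: c2].
have : \forall t \near x, c < a1 t - a2 t.
  by apply: (cvgr_gt _ cg); rewrite /c; lra.
move=> /nbhs_ballP[d /= d0 dP].
(* Close enough to [x] both for the lower bound [c] and for [H]. *)
pose v := x + Num.min d e / 2.
have m0 : 0 < Num.min d e by rewrite lt_min d0 e0.
have md : Num.min d e <= d by rewrite ge_min lexx.
have me : Num.min d e <= e by rewrite ge_min lexx orbT.
have xv : x < v by rewrite ltrDl divr_gt0.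
have ve : v < x + e by rewrite /v ltrD2l; lra.
have int (a : R -> R) : continuous a ->
    lebesgue_measure.-integrable `[x, v[ (EFin \o a).
  move=> ca; apply: (@integrableS _ (measurableTypeR R) R lebesgue_measure `[x, v]%classic) => //.
    by move=> t /=; rewrite !in_itv/= => /andP[-> /ltW].
  apply: continuous_compact_integrable; first exact: segment_compact.
  by apply: continuous_subspaceT.
have /(_ v) := H; rewrite xv ve => /(_ isT) /eqP; rewrite -subr_eq0 -RintegralB//; [|exact: int..].
have : \int[lebesgue_measure]_(t in `[x, v[) c <=
    \int[lebesgue_measure]_(t in `[x, v[) (a1 t - a2 t).
  apply: le_Rintegral => //.
  - by apply: int; move=> t; exact: cvg_cst.
  - by apply: int => t; apply: cvgB; [exact: c1|exact: c2].
  - move=> t /=; rewrite in_itv/= => /andP[xt tv]; apply/ltW/dP.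
    by rewrite /ball/= ltr_distlC; rewrite /v in tv; apply/andP; split; lra.
have lm : fine (lebesgue_measure `[x, v[%classic) = v - x.
  by rewrite lebesgue_measure_itv/= lte_fin xv.
rewrite Rintegral_cst// [fine _]lm => h /eqP h0.
by move: h; rewrite h0 leNgt mulr_gt0// subr_gt0.
Qed.

Lemma eq_continuous_Rintegral (a1 a2 : R -> R) (x e : R) : 0 < e ->
  continuous a1 -> continuous a2 ->
  (forall v, x < v < x + e -> \int[lebesgue_measure]_(t in `[x, v[) a1 t =
     \int[lebesgue_measure]_(t in `[x, v[) a2 t) ->
  a1 x = a2 x.
Proof.
move=> e0 c1 c2 H; apply/eqP; rewrite eq_le.
rewrite (le_continuous_Rintegral e0 c1 c2 H).
by rewrite (le_continuous_Rintegral e0 c2 c1)// => v xv; rewrite H.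
Qed.

Section versions.
Variables (mu1 mu2 : {measure set U -> \bar R}) (z : 'rV[R]_n) (phi : R -> R).
Hypotheses (mu1T : mu1 setT = 1%E) (mu2T : mu2 setT = 1%E).
Hypothesis bphi : bounded_measurable phi.
Variables m1 f1 m2 f2 : R -> R.
Hypotheses
  (m1P : is_cond_expectation mu1 (@threshold R n z) (phi \o @outcome R n) m1)
  (f1P : is_density lebesgue_measure (pushforward mu1 (@threshold R n z)) f1)
  (m2P : is_cond_expectation mu2 (@threshold R n z) (phi \o @outcome R n) m2)
  (f2P : is_density lebesgue_measure (pushforward mu2 (@threshold R n z)) f2).

Let m1oo : (mu1 setT < +oo)%E. Proof. by rewrite mu1T ltry. Qed.
Let m2oo : (mu2 setT < +oo)%E. Proof. by rewrite mu2T ltry. Qed.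

Lemma versions_a_eq (O : set R) : open O -> O `<=` agreement mu1 mu2 z ->
  continuous (m1 \* f1) -> continuous (m2 \* f2) ->
  forall x, O x -> m1 x * f1 x = m2 x * f2 x.
Proof.
move=> oO OD c1 c2 x Ox.
have /nbhs_ballP[e /= e0 eO] : nbhs x O by exact: open_nbhs_nbhs.
apply: (eq_continuous_Rintegral e0 c1 c2) => v /andP[xv ve].
rewrite -(version_a_integral mu1T m1P f1P)// -(version_a_integral mu2T m2P f2P)//.
(* The interval becomes the weight and [phi] a bounded function of the outcome, to be reduced to
   indicators of sets [E], for which agreement is known. *)
pose w u : R := \1_(@threshold R n z @^-1` `[x, v[%classic) u.
have mI : measurable (@threshold R n z @^-1` `[x, v[%classic).
  by apply: measurable_preimage => //; exact: measurable_threshold.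
transitivity (\int[mu1]_u (w u * phi (outcome u))).
  by apply: eq_Rintegral => u _; rewrite mulrC.
transitivity (\int[mu2]_u (w u * phi (outcome u))); last first.
  by apply: eq_Rintegral => u _; rewrite mulrC.
apply: eq_Rintegral_indic_comp => //.
- exact: bounded_measurable_indic.
- exact: measurable_outcome.
move=> E mE; have mYE : measurable (@outcome R n @^-1` E).
  by apply: measurable_preimage => //; exact: measurable_outcome.
rewrite !(@Rintegral_indic_setI _ _ _ _ (@outcome R n @^-1` E))// ![_ @^-1` `[x, v[ `&` _]setIC.
have xb : ball x e x by exact: ballxx.
have vb : ball x e v by rewrite /ball/= ltr_distlC; apply/andP; split; lra.
by rewrite (agreement_itv mE (ltW xv) mu1T mu2T)//; apply/OD/eO.
Qed.

(** Away from the support of [V], only the weights [phi] are controlled and not the indicators of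
    sets of outcomes; so here [phi] is the weight and [h] is reduced to indicators. *)
Lemma versions_a_integral h : (forall x, m1 x * f1 x = m2 x * f2 x) ->
  bounded_measurable h ->
  \int[mu1]_u (phi (outcome u) * h (threshold z u)) =
  \int[mu2]_u (phi (outcome u) * h (threshold z u)).
Proof.
move=> a12 bh; apply: eq_Rintegral_indic_comp => //.
- split; first by case: bphi => mphi _; exact: measurableT_comp mphi measurable_outcome.
  by case: bphi => _ [M phiM]; exists M.
- exact: measurable_threshold.
- move=> A mA; rewrite (version_a_integral mu1T m1P f1P)// (version_a_integral mu2T m2P f2P)//.
  by apply: eq_Rintegral => t _; exact: a12.
Qed.

End versions.
End density_weight.

(** * Agreement of the characteristic functions *)

Lemma continuous_dot {R : realType} {n : nat} (u : 'rV[R]_n) : continuous (dot u).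
Proof.
rewrite (_ : dot u = fun v => \sum_i u ord0 i * v ord0 i); last first.
  by apply/funext => v; exact: dotE.
apply: continuous_big; first exact: add_continuous.
by move=> i _ v; apply: continuousM; [exact: cst_continuous|exact: coord_continuous].
Qed.

Lemma identifying_class_bounded (R : realType) (P : set (R -> R)) phi :
  identifying_class P -> P phi -> bounded_measurable phi.
Proof.
move=> [Pb _] /Pb[mphi [M [_ phiM]]]; split => //.
(* Boundedness provides every bound larger than [M], not [M] itself. *)
by exists (M + 1)%R => y; apply: phiM => //; rewrite ltrDl.
Qed.

Section trigonometric_agreement.
Context {R : realType} {n : nat}.
Local Notation U := (R * R * 'rV[R]_n)%type.
Implicit Types (mu : {measure set U -> \bar R}) (phi : R -> R).

Definition trig_agree mu1 mu2 phi (z : 'rV[R]_n) : Prop := forall s : R,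
  \int[mu1]_u (phi (outcome u) * cos (s * threshold z u)) =
  \int[mu2]_u (phi (outcome u) * cos (s * threshold z u)) /\
  \int[mu1]_u (phi (outcome u) * sin (s * threshold z u)) =
  \int[mu2]_u (phi (outcome u) * sin (s * threshold z u)).

Lemma bounded_measurable_outcome phi : bounded_measurable phi ->
  bounded_measurable (fun u : U => phi (outcome u)).
Proof.
move=> [mphi [M phiM]]; split; last by exists M.
exact: measurableT_comp mphi measurable_outcome.
Qed.

Lemma bounded_measurable_cos (s : R) : bounded_measurable (fun t => cos (s * t)).
Proof.
split; last by exists 1 => t; exact: cos_max.
apply: (measurableT_comp (continuous_measurable_fun (@continuous_cos R))).
by apply: measurable_funM => //; exact: measurable_id.
Qed.

Lemma bounded_measurable_sin (s : R) : bounded_measurable (fun t => sin (s * t)).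
Proof.
split; last by exists 1 => t; exact: sin_max.
apply: (measurableT_comp (continuous_measurable_fun (@continuous_sin R))).
by apply: measurable_funM => //; exact: measurable_id.
Qed.

Section two_measures.
Variables (mu1 mu2 : {measure set U -> \bar R}).
Hypotheses (mu1T : mu1 setT = 1%E) (mu2T : mu2 setT = 1%E).

Let m1oo : (mu1 setT < +oo)%E. Proof. by rewrite mu1T ltry. Qed.
Let m2oo : (mu2 setT < +oo)%E. Proof. by rewrite mu2T ltry. Qed.

(** Stated for a general sequence of phases because it serves twice: for [z] tending to a limit, and
    for [s] tending to [0]. *)
Lemma trig_limit phi (l : nat -> U -> R) (l0 : U -> R) :
  bounded_measurable phi -> (forall k, measurable_fun setT (l k)) ->
  (forall u, l k u @[k --> \oo] --> l0 u) ->
  (forall k, \int[mu1]_u (phi (outcome u) * cos (l k u)) =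
             \int[mu2]_u (phi (outcome u) * cos (l k u)) /\
             \int[mu1]_u (phi (outcome u) * sin (l k u)) =
             \int[mu2]_u (phi (outcome u) * sin (l k u))) ->
  \int[mu1]_u (phi (outcome u) * cos (l0 u)) =
  \int[mu2]_u (phi (outcome u) * cos (l0 u)) /\
  \int[mu1]_u (phi (outcome u) * sin (l0 u)) =
  \int[mu2]_u (phi (outcome u) * sin (l0 u)).
Proof.
move=> /bounded_measurable_outcome[mphi [M phiM]] ml ll H.
have lim (mu : {measure set U -> \bar R}) (c : R -> R) : (mu setT < +oo)%E ->
    continuous c -> (forall t, `|c t| <= 1) ->
    \int[mu]_u (phi (outcome u) * c (l k u)) @[k --> \oo] -->
    \int[mu]_u (phi (outcome u) * c (l0 u)).
  move=> muT cc c1; apply: (@bounded_cvg_Rintegral _ _ _ _ _ _ M) => //.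
  - move=> k; apply: measurable_funM => //.
    exact: measurableT_comp (continuous_measurable_fun cc) (ml k).
  - by move=> k u; rewrite normrM -[leRHS]mulr1 ler_pM.
  - by move=> u; apply: cvgMr; apply: continuous_cvg; [exact: cc|exact: ll].
split.
- have c1 := lim _ _ m1oo (@continuous_cos R) (@cos_max R).
  have c2 := lim _ _ m2oo (@continuous_cos R) (@cos_max R).
  have E : (fun k => \int[mu1]_u (phi (outcome u) * cos (l k u))) =
           (fun k => \int[mu2]_u (phi (outcome u) * cos (l k u))).
    by apply/funext => k; case: (H k).
  by rewrite E in c1; exact: cvg_unique c1 c2.
- have c1 := lim _ _ m1oo (@continuous_sin R) (@sin_max R).
  have c2 := lim _ _ m2oo (@continuous_sin R) (@sin_max R).
  have E : (fun k => \int[mu1]_u (phi (outcome u) * sin (l k u))) =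
           (fun k => \int[mu2]_u (phi (outcome u) * sin (l k u))).
    by apply/funext => k; case: (H k).
  by rewrite E in c1; exact: cvg_unique c1 c2.
Qed.

Lemma closed_trig_agree phi : bounded_measurable phi ->
  closed [set z | trig_agree mu1 mu2 phi z].
Proof.
move=> bphi; apply: closed_seq => w z Hw wz s.
apply: (@trig_limit phi (fun k u => s * threshold (w k) u)) => //.
- by move=> k; apply: measurable_funM => //; exact: measurable_threshold.
- move=> u; apply: cvgMr; apply: cvgD; first exact: cvg_cst.
  exact: (continuous_cvg _ (@continuous_dot R n u.2 z) wz).
- by move=> k; exact: Hw.
Qed.

Lemma trig_agree_ray phi : bounded_measurable phi ->
  (forall z, trig_agree mu1 mu2 phi z) -> forall a b,
  \int[mu1]_u (phi (outcome u) * \1_(ray a b) u) =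
  \int[mu2]_u (phi (outcome u) * \1_(ray a b) u).
Proof.
move=> bphi H; apply: eq_trig_eq_ray => //; first exact: bounded_measurable_outcome.
have H0 s (xi : 'rV[R]_n) : s != 0 ->
    \int[mu1]_u (phi (outcome u) * cos (s * u.1.2 + dot u.2 xi)) =
    \int[mu2]_u (phi (outcome u) * cos (s * u.1.2 + dot u.2 xi)) /\
    \int[mu1]_u (phi (outcome u) * sin (s * u.1.2 + dot u.2 xi)) =
    \int[mu2]_u (phi (outcome u) * sin (s * u.1.2 + dot u.2 xi)).
  (* The character with frequencies [s] and [xi] is that of the threshold at [xi / s], at frequency
     [s]. *)
  move=> s0; have := H (s^-1 *: xi) s.
  rewrite (_ : (fun u : U => phi (outcome u) * cos (s * threshold (s^-1 *: xi) u)) =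
    (fun u : U => phi (outcome u) * cos (s * u.1.2 + dot u.2 xi))); last first.
    apply/funext => u; congr (_ * cos _); rewrite /threshold mulrDr !dotE mulr_sumr.
    by congr (_ + _); apply: eq_bigr => i _; rewrite !mxE; field.
  rewrite (_ : (fun u : U => phi (outcome u) * sin (s * threshold (s^-1 *: xi) u)) =
    (fun u : U => phi (outcome u) * sin (s * u.1.2 + dot u.2 xi)))//.
  apply/funext => u; congr (_ * sin _); rewrite /threshold mulrDr !dotE mulr_sumr.
  by congr (_ + _); apply: eq_bigr => i _; rewrite !mxE; field.
(* [s = 0] is not of the form [s * threshold z]. *)
move=> s xi; have [->|s0] := eqVneq s 0; last exact: H0.
apply: (@trig_limit phi (fun k (u : U) => k.+1%:R^-1 * u.1.2 + dot u.2 xi)) => //.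
- move=> k; apply: measurable_funD.
    by apply: measurable_funM => //; exact: measurable_theta.
  by apply: measurable_dot => //; exact: measurable_gamma.
- move=> u; apply: cvgD; last exact: cvg_cst.
  by apply: cvgMl; exact: cvg_harmonic.
- by move=> k; apply: H0; rewrite invr_eq0 pnatr_eq0.
Qed.

Lemma eq_law_indicators :
  (forall E, measurable E -> forall z, trig_agree mu1 mu2 (\1_E) z) ->
  forall A, measurable A -> mu1 A = mu2 A.
Proof.
move=> H; apply: eq_measure_rays => // E a b mE.
have mYE : measurable (@outcome R n @^-1` E).
  by apply: measurable_preimage => //; exact: measurable_outcome.
have := trig_agree_ray (bounded_measurable_indic mE) (H _ mE) a b.
have mYEr : measurable (@outcome R n @^-1` E `&` ray a b).
  by apply: measurableI => //; exact: measurable_ray.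
rewrite !(@Rintegral_indic_setI _ _ _ (@outcome R n @^-1` E))//; try exact: measurable_ray.
have fin mu : (mu setT < +oo)%E -> mu (@outcome R n @^-1` E `&` ray a b) \is a fin_num.
  move=> muT; rewrite ge0_fin_numE// (le_lt_trans _ muT)//.
  by rewrite le_measure ?inE.
by move=> h; rewrite -[LHS]fineK ?fin// h fineK// fin.
Qed.

Lemma integral_restricted_outcome mu phi (A : set U) (mA : measurable A)
    (muT : (mu setT < +oo)%E) (rT : (mrestr mu mA setT < +oo)%E) :
  bounded_measurable phi ->
  (\int[fpush measurable_outcome rT]_y (phi y)%:E =
   (\int[mu]_u (phi (outcome u) * \1_A u))%:E)%E.
Proof.
move=> bphi; have [mphi _] := bphi; have bphiY := bounded_measurable_outcome bphi.
have mY := @measurable_outcome R n.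
(* The pushforwards by the identity only repackage [mu] and its restriction as finite measures. *)
pose mu' : {finite_measure set U -> \bar R} := fpush (@measurable_id _ U setT) muT.
pose nu : {finite_measure set U -> \bar R} := fpush (@measurable_id _ U setT) rT.
have dA : is_density mu' nu (\1_A).
  split=> [|x|B mB]; [exact: measurable_indic|by rewrite indicE|].
  by rewrite integral_indic// setIC.
transitivity (\int[nu]_u (phi (outcome u))%:E)%E.
  rewrite (@integral_pushforward _ _ _ _ _ _ mY (mrestr mu mA) setT (EFin \o phi))//.
    exact/measurable_EFinP.
  by rewrite preimage_setT; apply: bounded_measurable_integrable.
rewrite (integral_density_EFin dA); last by case: bphiY.
rewrite /Rintegral fineK//.
apply: integrable_fin_num => //; apply: bounded_measurable_integrable => //.
by apply: bounded_measurableM => //; exact: bounded_measurable_indic.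
Qed.

(** For a fixed ray, the outcome restricted to it has a finite measure as law, whose integrals
    against [Phi] are known. Its mass is not fixed in advance, which is why an identifying class has
    to determine measures up to mass. *)
Lemma eq_law_identifying (Phi : set (R -> R)) : identifying_class Phi ->
  (forall phi, Phi phi -> forall z, trig_agree mu1 mu2 phi z) ->
  forall A, measurable A -> mu1 A = mu2 A.
Proof.
move=> idPhi H; apply: eq_measure_rays => // E a b mE.
have mr := @measurable_ray R n a b.
have r1 mu : (mu setT < +oo)%E -> (mrestr mu mr setT < +oo)%E.
  move=> muT; apply: le_lt_trans muT; rewrite /mrestr setTI.
  by apply: (@le_measure _ _ _ mu); rewrite ?inE.
apply: (proj2 idPhi (fpush measurable_outcome (r1 _ m1oo)) (fpush measurable_outcome (r1 _ m2oo))) => //.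
move=> phi Phiphi.
have bphi := identifying_class_bounded idPhi Phiphi.
rewrite !integral_restricted_outcome//; congr EFin.
by apply: trig_agree_ray => //; exact: H.
Qed.

End two_measures.

Lemma complex_expectation_trig mu phi (s : R) (z : 'rV[R]_n) :
  complex_expectation mu (fun u : U =>
    cis (u.1.2 * s) * cis (dot u.2 z * s) * (phi (outcome u))%:C) =
  \int[mu]_u (phi (outcome u) * cos (s * threshold z u)) +i*
  \int[mu]_u (phi (outcome u) * sin (s * threshold z u)).
Proof.
rewrite /complex_expectation; congr (_ +i* _); apply: eq_Rintegral => u _;
  rewrite /cis /threshold mulrDr /=.
  by rewrite cosD ![s * _]mulrC; ring.
by rewrite sinD ![s * _]mulrC; ring.
Qed.

End trigonometric_agreement.

(** * Identification *)

Section almost_everywhere.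
Local Open Scope ereal_scope.

Lemma ae_measure_eq d (T : measurableType d) (R : realType)
    (mu : {measure set T -> \bar R}) (A B : set T) :
  measurable A -> measurable B -> {ae mu, forall w, A w <-> B w} -> mu A = mu B.
Proof.
move=> mA mB AB; rewrite -(setIT A) -(setIT B) -!integral_indic//.
apply: ae_eq_integral => //; try exact/measurable_EFinP/measurable_indic.
apply: filterS AB => w AB _; rewrite !indicE; congr (nat_of_bool _)%:R%:E.
by apply/idP/idP => /set_mem wA; apply/mem_set/AB.
Qed.

Lemma ae_measure_transfer d (T : measurableType d) (R : realType)
    (mu nu : {measure set T -> \bar R}) (Q : set T) :
  (forall A, measurable A -> mu A = nu A) ->
  {ae mu, forall w, Q w} -> {ae nu, forall w, Q w}.
Proof. by move=> E [N [mN N0 QN]]; exists N; split => //; rewrite -E. Qed.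

Lemma ae_exists d (T : measurableType d) (R : realType)
    (mu : {measure set T -> \bar R}) (Q : set T) :
  mu setT = 1 -> {ae mu, forall w, Q w} -> exists w, Q w.
Proof.
move=> mu1 [N [mN N0 QN]]; apply: contrapT => nQ.
have NT : N = setT by apply/seteqP; split => // w _; apply: QN => Qw; apply: nQ; exists w.
by move: N0; rewrite NT mu1 => /eqP; rewrite eqe oner_eq0.
Qed.

Lemma msupport_ae_rV (R : realType) (n : nat) (mu : {measure set 'rV[R]_n -> \bar R})
    (D : set 'rV[R]_n) :
  closed D -> {ae mu, forall z, D z} -> msupport mu `<=` D.
Proof.
move=> cD aeD; apply: msupport_sub => //; apply: measure_negligible => //.
by apply: measurable_open_rV; exact: closed_openC.
Qed.

Lemma msupport_ae (R : realType) (mu : {measure set R -> \bar R}) (D : set R) :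
  closed D -> {ae mu, forall z, D z} -> msupport mu `<=` D.
Proof.
move=> cD aeD; apply: msupport_sub => //; apply: measure_negligible => //.
by apply: open_measurable; exact: closed_openC.
Qed.

(** Only countably many sets are tested, so that an equality valid almost everywhere for each set
    becomes one valid for all sets almost everywhere. *)
Lemma eq_measure_rational_rays (R : realType) (m1 m2 : {measure set R -> \bar R}) :
  m1 setT < +oo -> (forall q : rat, m1 `]-oo, ratr q[%classic = m2 `]-oo, ratr q[%classic) ->
  forall A, measurable A -> m1 A = m2 A.
Proof.
move=> m1T h A mA; pose G : set (set R) := [set `]-oo, ratr q[%classic | q in [set: rat]].
have Gm : G `<=` measurable by move=> _ [q _ <-]; exact: measurable_itv.
apply: (g_sigma_algebra_measure_unique G Gm (fun k => `]-oo, ratr k%:R[%classic)).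
- by move=> k; exists k%:R.
- apply/seteqP; split=> // t _; exists (Num.bound `|t|) => //=; rewrite in_itv/=.
  by rewrite (le_lt_trans (ler_norm _))// ratr_nat archi_boundP.
- move=> _ _ [q _ <-] [r _ <-]; exists (Num.min q r) => //.
  apply/seteqP; split=> t /=; rewrite !in_itv/=.
    by move=> tqr; split; apply: (lt_le_trans tqr); rewrite ler_rat ge_min lexx ?orbT.
  by move=> [tq tr]; rewrite /Num.min; case: ifP.
- by move=> _ [q _ <-]; exact: h.
- by move=> k; rewrite (le_lt_trans _ m1T)// le_measure ?inE.
- pose TG : measurableType _ := g_sigma_algebraType G.
  have mid : measurable_fun setT (fun t : TG => (t : R)).
    apply: (measurability _ (RGenInftyO.measurableE R)).
    move=> _ [_ [a ->] <-]; rewrite setTI.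
    rewrite [X in measurable X](_ : _ = \bigcup_(q : rat)
      if (ratr q < a)%R then `]-oo, ratr q[%classic : set TG else set0).
      apply: countable_bigcupT_measurable => // q; case: ifP => // _.
      by apply: sub_sigma_algebra; exists q.
    apply/seteqP; split=> t /=; rewrite in_itv/=.
      move=> /rat_in_itvoo[q]; rewrite in_itv/= => /andP[tq qa].
      by exists q => //; rewrite qa /= in_itv.
    by move=> [q _]; case: ifP => // qa; rewrite /= in_itv/= => /lt_trans; apply.
  by have := mid measurableT A mA; rewrite setTI.
Qed.

End almost_everywhere.

(** * Comparison of two structures *)

Section structures.
Context {R : realType} {p n : nat}.
Implicit Types S : structure R p n.
Local Open Scope ereal_scope.
Local Notation pair S := (@rv_pair _ _ _ (Pr S) _ _ _ _).
Local Notation W S := (pair S (X S) (pair S (V S) (Z S))).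
Local Notation US S := (pair S (pair S (Y S) (Theta S)) (Gamma S)).
Local Notation U := (R * R * 'rV[R]_n)%type.
Local Notation TW := ('rV[R]_p * (R * 'rV[R]_n))%type.

(** Only the order of the latent components changes, from that of the assumption to that of
    [law_U]. *)
Lemma cond_independent_latent S :
  instrument_independence S -> cond_independent (X S) (pair S (V S) (Z S)) (US S).
Proof.
move=> ind A B mA mB q r qP rP.
pose sw (w : R * 'rV[R]_n * R) : U := ((w.2, w.1.1), w.1.2).
have msw : measurable_fun setT sw.
  apply: measurable_fun_pair; last exact: measurableT_comp measurable_snd measurable_fst.
  apply: measurable_fun_pair; first exact: measurable_snd.
  exact: measurableT_comp measurable_fst measurable_fst.
by have := ind A (sw @^-1` B) mA (measurable_preimage msw mB) q r qP rP.
Qed.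

Definition selected_set (C : set TW) (E : set R) : set (TW * U) :=
  [set wu | C wu.1 /\ below wu.1.2.2 E wu.1.2.1 wu.2].

Lemma measurable_selected_set C E : measurable C -> measurable E ->
  measurable (selected_set C E).
Proof.
move=> mC mE.
have -> : selected_set C E = fst @^-1` C `&` ((@outcome R n \o snd) @^-1` E `&`
    ((fun wu : TW * U => wu.1.2.1 - threshold wu.1.2.2 wu.2)%R @^-1` `]0%R, +oo[%classic)).
  by apply/seteqP; split=> wu; rewrite /selected_set /below /= in_itv/= subr_gt0 andbT.
have m1 : measurable_fun setT (fun wu : TW * U => wu.1.2.1).
  apply: measurableT_comp measurable_fst _.
  exact: measurableT_comp measurable_snd measurable_fst.
have m2 : measurable_fun setT (fun wu : TW * U => wu.1.2.2).
  apply: measurableT_comp measurable_snd _.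
  exact: measurableT_comp measurable_snd measurable_fst.
apply: measurableI; first by apply: measurable_preimage => //; exact: measurable_fst.
apply: measurableI; apply: measurable_preimage => //.
  exact: measurableT_comp measurable_outcome measurable_snd.
apply: measurable_funB => //.
exact: measurableT_comp measurable_threshold2 (measurable_fun_pair m2 measurable_snd).
Qed.

Lemma xsection_selected_set C E w :
  xsection (selected_set C E) w = if w \in C then below w.2.2 E w.2.1 else set0.
Proof.
apply/seteqP; split=> u; rewrite /xsection /selected_set /=.
  by move=> /set_mem[/= Cw wu]; rewrite mem_set.
by case: ifPn => // /set_mem Cw wu; apply/mem_set.
Qed.

Lemma measurable_law_below (k : R.-pker 'rV[R]_p ~> U) E : measurable E ->
  measurable_fun setT (fun w : TW => k w.1 (below w.2.2 E w.2.1)).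
Proof.
move=> mE; have := measurable_kernel_xsection (kpre k (@measurable_fst _ _ 'rV[R]_p (R * 'rV[R]_n)%type))
  (measurable_selected_set measurableT mE).
congr measurable_fun; apply/funext => w.
by rewrite xsection_selected_set in_setT.
Qed.

Definition reorder (o : 'rV[R]_p * R * 'rV[R]_n * bool * R) : TW :=
  (o.1.1.1.1, (o.1.1.1.2, o.1.1.2)).

Lemma measurable_reorder : measurable_fun setT reorder.
Proof.
have f1 : measurable_fun setT (fun o : 'rV[R]_p * R * 'rV[R]_n * bool * R => o.1.1).
  exact: measurableT_comp measurable_fst measurable_fst.
have f2 : measurable_fun setT (fun o : 'rV[R]_p * R * 'rV[R]_n * bool * R => o.1.1.1).
  exact: measurableT_comp measurable_fst f1.
apply: measurable_fun_pair; first exact: measurableT_comp measurable_fst f2.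
apply: measurable_fun_pair; first exact: measurableT_comp measurable_snd f2.
exact: measurableT_comp measurable_snd f1.
Qed.

Definition observed_set (C : set TW) (E : set R) :
    set ('rV[R]_p * R * 'rV[R]_n * bool * R) :=
  reorder @^-1` C `&` ((fun o => o.1.2) @^-1` [set true] `&` snd @^-1` E).

Lemma measurable_observed_set C E : measurable C -> measurable E ->
  measurable (observed_set C E).
Proof.
move=> mC mE; apply: measurableI.
  by apply: measurable_preimage => //; exact: measurable_reorder.
apply: measurableI; apply: measurable_preimage => //.
exact: measurableT_comp measurable_snd measurable_fst.
Qed.

Lemma observed_law_W S C : measurable C ->
  distribution (Pr S) (W S) C = observed_law S (reorder @^-1` C).
Proof. by []. Qed.

(** The selection equation identifies the observed event with [selected_set] up to a null set, and
    by independence the latent variables given [(X, V, Z)] have law [law_U] at [X]; the section of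
    [selected_set] is an event [below]. *)
Lemma observed_law_selected S (k : cond_laws S) C E :
  selection_equation S -> instrument_independence S -> measurable C -> measurable E ->
  observed_law S (observed_set C E) =
  \int[distribution (Pr S) (W S)]_(w in C) law_U k w.1 (below w.2.2 E w.2.1).
Proof.
move=> sel ind mC mE.
have mS := measurable_selected_set mC mE.
have -> : observed_law S (observed_set C E) =
    distribution (Pr S) (pair S (W S) (US S)) (selected_set C E).
  rewrite /observed_law /distribution /pushforward.
  have -> : @observables R p n S @^-1` observed_set C E =
      W S @^-1` C `&` (Sel S @^-1` [set true] `&` Y S @^-1` E).
    apply/seteqP; split=> w; rewrite /observables.
      by move=> [Cw [/= Sw]]; rewrite Sw => Ew; split.
    by move=> [Cw [/= Sw Ew]]; split => //; split => //=; rewrite Sw.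
  apply: ae_measure_eq.
  - have mSel : measurable (Sel S @^-1` [set true]).
      exact: measurable_preimage (measurable_funPT _) _.
    have mY : measurable (Y S @^-1` E) by exact: measurable_preimage (measurable_funPT _) mE.
    have mW : measurable (W S @^-1` C) by exact: measurable_preimage (measurable_funPT _) mC.
    by apply: measurableI => //; exact: measurableI.
  - exact: measurable_preimage (measurable_funPT _) mS.
  - apply: filterS sel => w Sw; rewrite /selected_set /below /= Sw.
    rewrite /outcome /threshold /= -addrA -opprD subr_gt0; tauto.
rewrite (cond_independent_law (cond_independent_latent ind) (law_UP k))// /mixture.
rewrite [RHS]integral_mkcond; apply: eq_integral => w _.
rewrite patchE xsection_selected_set; case: ifPn => // _.
by rewrite measure0.
Qed.

Section two_structures.
Variables (S1 S2 : structure R p n) (k1 : cond_laws S1) (k2 : cond_laws S2).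
Hypotheses (sel1 : selection_equation S1) (sel2 : selection_equation S2).
Hypotheses (ind1 : instrument_independence S1) (ind2 : instrument_independence S2).
Hypothesis hobs : forall A, measurable A -> observed_law S1 A = observed_law S2 A.

Lemma law_W_eq C : measurable C ->
  distribution (Pr S1) (W S1) C = distribution (Pr S2) (W S2) C.
Proof.
move=> mC; rewrite !observed_law_W// hobs//.
by apply: measurable_preimage => //; exact: measurable_reorder.
Qed.

Lemma law_XZ_eq C : measurable C -> law_XZ S1 C = law_XZ S2 C.
Proof.
move=> mC; pose f (w : TW) := (w.1, w.2.2).
have mf : measurable_fun setT f.
  apply: measurable_fun_pair; first exact: measurable_fst.
  exact: measurableT_comp measurable_snd measurable_snd.
exact: (law_W_eq (measurable_preimage mf mC)).
Qed.

Lemma law_X_eq C : measurable C -> law_X S1 C = law_X S2 C.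
Proof. by move=> mC; exact: (law_W_eq (measurable_preimage measurable_fst mC)). Qed.

(** Both functions have the same integrals over every measurable set, with respect to the common law
    of [(X, V, Z)]. *)
Lemma ae_law_below E : measurable E ->
  {ae distribution (Pr S1) (W S1), forall w,
    law_U k1 w.1 (below w.2.2 E w.2.1) = law_U k2 w.1 (below w.2.2 E w.2.1)}.
Proof.
move=> mE.
have := @integral_ae_eq _ _ _ (distribution (Pr S1) (W S1)) setT measurableT
  (fun w => law_U k2 w.1 (below w.2.2 E w.2.1))
  (fun w => law_U k1 w.1 (below w.2.2 E w.2.1)).
move=> H; apply: filterS (H _ _ _) => [w /(_ I)//| | |].
- rewrite (_ : (fun w => _) = EFin \o (fun w => fine (law_U k1 w.1 (below w.2.2 E w.2.1)))).
    apply: bounded_measurable_integrable.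
      by rewrite (le_lt_trans (probability_le1 _ _))// ltry.
    split; first by apply: measurableT_comp => //; exact: measurable_law_below.
    exists 1%R => w; rewrite ger0_norm ?fine_ge0// -lee_fin fineK.
      rewrite -(prob_kernel (s := law_U k1) w.1) le_measure ?inE//.
      exact: measurable_below.
    by apply: finite_kernel_measure; exact: measurable_below.
  apply/funext => w /=; rewrite fineK//.
  by apply: finite_kernel_measure; exact: measurable_below.
- exact: measurable_law_below.
- move=> A _ mA; rewrite -observed_law_selected// hobs; last exact: measurable_observed_set.
  rewrite (observed_law_selected k2)//; apply: eq_measure_integral => B mB _.
  exact: esym (law_W_eq mB).
Qed.

Lemma ae_law_agreement :
  {ae distribution (Pr S1) (W S1), forall w,
    agreement (law_U k1 w.1) (law_U k2 w.1) w.2.2 w.2.1}.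
Proof.
(* An enumeration of the rational half-lines; codes of no rational give the empty set. *)
pose F (m : nat) : set R :=
  if @choice.unpickle rat m is Some q then `]-oo, ratr q[%classic else set0.
have mF m : measurable (F m) by rewrite /F; case: choice.unpickle.
have := ae_foralln (fun m => ae_law_below (mF m)).
apply: filterS => w Hw E mE.
have mY := @measurable_outcome R n.
pose B := @threshold R n w.2.2 @^-1` `]-oo, w.2.1[%classic.
have mB : measurable B by apply: measurable_preimage => //; exact: measurable_threshold.
have r1 (k : R.-pker 'rV[R]_p ~> U) : mrestr (k w.1) mB setT < +oo.
  rewrite /mrestr setTI (le_lt_trans _ (ltry 1))// -(prob_kernel (s := k) w.1).
  by apply: (@le_measure _ _ _ (k w.1)); rewrite ?inE.
pose nu k := fpush mY (r1 k).
have nuE k A : nu k A = k w.1 (below w.2.2 A w.2.1) by rewrite belowE.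
rewrite -(nuE (law_U k1)) -(nuE (law_U k2)).
apply: eq_measure_rational_rays => //; first by rewrite ltey_eq fin_num_measure.
move=> q; have := Hw (@choice.pickle rat q); rewrite /F choice.pickleK => Hq.
by apply: (etrans (nuE (law_U k1) _)); rewrite Hq; exact: esym (nuE (law_U k2) _).
Qed.

Lemma ae_law_V_agreement :
  \forall xz \ae law_XZ S1, {ae law_V k1 xz, forall v,
    agreement (law_U k1 xz.1) (law_U k2 xz.1) xz.2 v}.
Proof.
have : {ae distribution (Pr S1) (pair S1 (pair S1 (X S1) (Z S1)) (V S1)), forall w,
    agreement (law_U k1 w.1.1) (law_U k2 w.1.1) w.1.2 w.2}.
  have [N [mN N0 QN]] := ae_law_agreement.
  (* The triple is regrouped with [V] last, so that it can be disintegrated given [(X, Z)]. *)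
  pose f (w : 'rV[R]_p * 'rV[R]_n * R) : TW := (w.1.1, (w.2, w.1.2)).
  have mf : measurable_fun setT f.
    apply: measurable_fun_pair; first exact: measurableT_comp measurable_fst measurable_fst.
    apply: measurable_fun_pair; first exact: measurable_snd.
    exact: measurableT_comp measurable_snd measurable_fst.
  exists (f @^-1` N); split => //; first exact: measurable_preimage.
  by move=> w nQ; apply: QN.
by move=> H; exact: (ae_cond_law (law_VP k1) H).
Qed.

Hypotheses (dens1 : densities_exist k1) (dens2 : densities_exist k2).

Lemma ae_msupport_agreement :
  \forall xz \ae law_XZ S1,
    [/\ forall v, law_U k1 xz.1 (@threshold R n xz.2 @^-1` [set v]) = 0,
        forall v, law_U k2 xz.1 (@threshold R n xz.2 @^-1` [set v]) = 0 &
        msupport (law_V k1 xz) `<=` agreement (law_U k1 xz.1) (law_U k2 xz.1) xz.2].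
Proof.
(* Null sets of [(X, Z)] are the same for both structures, since this pair is observed. *)
have dens2' := ae_measure_transfer (fun A mA => esym (law_XZ_eq mA)) dens2.
move: ae_law_V_agreement dens1 dens2'; apply: filterS3 => xz ag [_ [f1 d1]] [_ [f2 d2]].
have a1 v := density_atomless v d1; have a2 v := density_atomless v d2.
split => //; apply: msupport_ae => //.
by apply: closed_agreement => //; exact: prob_kernel.
Qed.

(* Nothing is asked of the supports of [S2]: the two structures may satisfy
   different alternatives of the assumption. *)
Lemma full_support_identified : full_support k1 ->
  \forall x \ae law_X S1, forall B, measurable B -> law_U k1 x B = law_U k2 x B.
Proof.
move=> [fs1 fs2].
have : \forall xz \ae law_XZ S1, forall E, measurable E ->
    trig_agree (law_U k1 xz.1) (law_U k2 xz.1) (\1_E) xz.2.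
  move: ae_msupport_agreement fs1; apply: filterS2 => xz [a1 a2 sV] sT E mE s.
  have p1 : law_U k1 xz.1 setT = 1 by exact: prob_kernel.
  have p2 : law_U k2 xz.1 setT = 1 by exact: prob_kernel.
  have ag := full_support_agreement p1 p2 a1 a2 (subset_trans sT sV).
  split.
    exact: (agreement_integral mE p1 p2 ag (bounded_measurable_cos s)).
  exact: (agreement_integral mE p1 p2 ag (bounded_measurable_sin s)).
move=> /(ae_cond_law (law_ZP k1)); move: fs2; apply: filterS2 => x sZ ag.
have p1 : law_U k1 x setT = 1 by exact: prob_kernel.
have p2 : law_U k2 x setT = 1 by exact: prob_kernel.
apply: (eq_law_indicators p1 p2) => E mE z.
have cD := closed_trig_agree p1 p2 (bounded_measurable_indic mE).
have : msupport (law_Z k1 x) z by rewrite sZ.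
by apply: (msupport_ae_rV cD); apply: filterS ag => {}z /=; apply.
Qed.

Section quasi_analyticity.
Variables (Phi : 'rV[R]_p -> set (R -> R))
  (Ca : 'rV[R]_p -> 'rV[R]_n -> set (R -> R[i]))
  (Cb : R -> 'rV[R]_p -> set ('rV[R]_n -> R[i])).
Hypotheses (qa1 : quasi_analyticity k1 Phi Ca Cb) (qa2 : quasi_analyticity k2 Phi Ca Cb).

Lemma ae_trig_agree : \forall xz \ae law_XZ S1, forall phi, Phi xz.1 phi ->
  trig_agree (law_U k1 xz.1) (law_U k2 xz.1) phi xz.2.
Proof.
have qa2' := ae_measure_transfer (fun A mA => esym (law_XZ_eq mA)) qa2.
move: ae_msupport_agreement qa1 qa2'; apply: filterS3 => xz [_ _ sV].
move=> [[idP qC _] [iV _ H1]] [_ [_ _ H2]] phi Pphi s.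
have bphi := identifying_class_bounded idP Pphi.
(* Each structure has its own version of [a]; membership in the class makes both continuous, which
   removes the ambiguity of the choice. *)
have [[a1 [m1 [f1 [m1P f1P ->]]] Ca1] _] := H1 _ Pphi.
have [[a2 [m2 [f2 [m2P f2P ->]]] Ca2] _] := H2 _ Pphi.
have p1 : law_U k1 xz.1 setT = 1 by exact: prob_kernel.
have p2 : law_U k2 xz.1 setT = 1 by exact: prob_kernel.
have [c1 _] := quasi_analytic_continuous qC Ca1.
have [c2 _] := quasi_analytic_continuous qC Ca2.
have oV := open_interior (msupport (law_V k1 xz)).
have sO := subset_trans (@interior_subset _ (msupport (law_V k1 xz))) sV.
have aO := versions_a_eq p1 p2 bphi m1P f1P m2P f2P oV sO c1 c2.
have aE : (fun v => ((m1 \* f1)%R v)%:C) = (fun v => ((m2 \* f2)%R v)%:C).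
  by apply: (quasi_analytic_eq qC Ca1 Ca2 oV iV) => v Ov; rewrite /= aO.
have aT v : (m1 v * f1 v = m2 v * f2 v)%R by have /(congr1 (fun g => complex.Re (g v))) := aE.
split.
  exact: (versions_a_integral p1 p2 bphi m1P f1P m2P f2P aT (bounded_measurable_cos s)).
exact: (versions_a_integral p1 p2 bphi m1P f1P m2P f2P aT (bounded_measurable_sin s)).
Qed.

Lemma quasi_analytic_identified :
  \forall x \ae law_X S1, forall B, measurable B -> law_U k1 x B = law_U k2 x B.
Proof.
have qa2' := ae_measure_transfer (fun A mA => esym (law_XZ_eq mA)) qa2.
move: (ae_cond_law (law_ZP k1) ae_trig_agree) (ae_cond_law (law_ZP k1) qa1)
  (ae_cond_law (law_ZP k1) qa2'); apply: filterS3 => x aeT ae1 ae2.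
have p1 : law_U k1 x setT = 1 by exact: prob_kernel.
have p2 : law_U k2 x setT = 1 by exact: prob_kernel.
have pZ : law_Z k1 x setT = 1 by exact: prob_kernel.
(* The facts kept here depend on [x] alone but are assumed at almost every [(x, z)]; a single good
   [z] provides them. *)
have [z [[[idP _ qC] [_ iZ H1]] [_ [_ _ H2]]]] := ae_exists pZ (filterI ae1 ae2).
apply: (eq_law_identifying p1 p2 idP) => phi Pphi.
have bphi := identifying_class_bounded idP Pphi.
have cD := closed_trig_agree p1 p2 bphi.
have sD : msupport (law_Z k1 x) `<=` [set z | trig_agree (law_U k1 x) (law_U k2 x) phi z].
  by apply: (msupport_ae_rV cD); apply: filterS aeT => z' /(_ _ Pphi).
have bE s : fun_b k1 phi s x = fun_b k2 phi s x.
  have [_ /(_ s) b1] := H1 _ Pphi; have [_ /(_ s) b2] := H2 _ Pphi.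
  apply: (quasi_analytic_eq (qC s) b1 b2 (@open_interior _ _) iZ) => t /interior_subset/sD/(_ s).
  by rewrite /fun_b !complex_expectation_trig => -[-> ->].
move=> t s; have := congr1 (fun g => g t) (bE s).
by rewrite /fun_b !complex_expectation_trig => -[].
Qed.

End quasi_analyticity.
End two_structures.
End structures.

Theorem theorem4 (R : realType) (d p : nat) (hd : (2 <= d)%N)
    (Phi : 'rV[R]_p -> set (R -> R))
    (Ca : 'rV[R]_p -> 'rV[R]_(d - 2) -> set (R -> R[i]))
    (Cb : R -> 'rV[R]_p -> set ('rV[R]_(d - 2) -> R[i]))
    (S1 S2 : structure R p (d - 2))
    (k1 : cond_laws S1) (k2 : cond_laws S2)
    (h1 : assumptions k1 Phi Ca Cb) (h2 : assumptions k2 Phi Ca Cb)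
    (hobs : forall A, measurable A -> observed_law S1 A = observed_law S2 A) :
  \forall x \ae law_X S1,
    forall B, measurable B -> law_U k1 x B = law_U k2 x B.
Proof.
case: h1 h2 => sel1 ind1 dens1 [fs1|qa1] [sel2 ind2 dens2 fq2].
  exact: full_support_identified.
case: fq2 => [fs2|qa2]; last exact: quasi_analytic_identified qa1 qa2.
have hobs' A : measurable A -> observed_law S2 A = observed_law S1 A.
  by move=> mA; rewrite hobs.
(* The mixed case: the structures exchange roles, and the conclusion comes back because the law of
   [X] is common to both. *)
apply: (ae_measure_transfer (law_X_eq hobs')).
apply: filterS (full_support_identified sel2 sel1 ind2 ind1 hobs' dens2 dens1 fs2).
by move=> x E B mB; rewrite E.
Qed.
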